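(* Let $\mathcal{H}=(V,\mathcal{A})$ be a multi-head HyTN with integer weights, let $m=\sum_{A\in\mathcal{A}}|A|$ where $|A|=|H_A\cup\{t_A\}|$, and let $W=\max_{A\in\mathcal{A}}\max_{h\in H_A}|w_A(h)|$. Then: (1) there is an algorithm deciding whether $\mathcal{H}$ is consistent in time $O((|V|+|\mathcal{A}|)\,m\,W)$; (2) there is an algorithm running in time $O((|V|+|\mathcal{A}|)\,m\,W)$ that, given any consistent such $\mathcal{H}$, outputs a feasible scheduling $s:V\to\mathbb{Z}$; (3) there is an algorithm running in time $O((|V|+|\mathcal{A}|)\,m\,W)$ that, given any non-consistent such $\mathcal{H}$, outputs a negative cycle $(S,\mathcal{C})$ of $\mathcal{H}$.
   Context: A multi-head HyTN is a pair $\mathcal{H}=(V,\mathcal{A})$, $V$ a finite node set, $\mathcal{A}$ a finite set of hyperarcs $A=(t_A,H_A,w_A)$ with tail $t_A\in V$, nonempty head set $H_A\subseteq V\setminus\{t_A\}$ and weights $w_A(v)\in\mathbb{R}$ for $v\in H_A$. A scheduling $s:V\to\mathbb{R}$ is feasible if $s(t_A)\ge\min_{v\in H_A}\{s(v)-w_A(v)\}$ for all $A\in\mathcal{A}$; $\mathcal{H}$ is consistent if a feasible scheduling exists. A cycle is a pair $(S,\mathcal{C})$ with $S\subseteq V$, $\mathcal{C}\subseteq\mathcal{A}$, such that $S=\bigcup_{A\in\mathcal{C}}(H_A\cup\{t_A\})\neq\emptyset$ and for every $v\in S$ there is a unique $A\in\mathcal{C}$ with $t_A=v$, denoted $a(v)$.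 A finite cyclic sequence is a sequence $v_1,\ldots,v_p$ of nodes of $S$ with $v_{t+1}\in H_{a(v_t)}$ for $1\le t<p$, $v_p=v_1$, and no other repeated node. The cycle is negative if every finite cyclic sequence satisfies $\sum_{t=1}^{p-1}w_{a(v_t)}(v_{t+1})<0$.
   Formalization: The time bound is read as O((|V|+|A|) m max(W,1) + |V| + 1): it equals the stated one up to a constant when W ≥ 1, and replaces the impossible bound 0 when all weights are zero or there are no hyperarcs. *)

(* Defs.v *)
From Stdlib Require Import Reals.
From HB Require Import structures.
From mathcomp Require Import all_boot all_order all_algebra.
From mathcomp Require Import Rstruct.
Set Implicit Arguments. Unset Strict Implicit. Unset Printing Implicit Defensive.
Import Order.TTheory GRing.Theory Num.Theory.
Local Open Scope ring_scope.

(* Nodes are 0, ..., nnodes-1.  A hyperarc is a pair (t_A, heads)      *)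
(* where heads lists the pairs (h, w_A(h)) for h in H_A.               *)

Definition hyperarc := (nat * seq (nat * int))%type.
Definition tailA (A : hyperarc) : nat := A.1.
Definition headsA (A : hyperarc) : seq nat := map fst A.2.
(* w_A(v) (only meaningful for v in H_A) *)
Definition weightA (A : hyperarc) (v : nat) : int :=
  odflt (0 : int) (omap snd (ohead [seq p <- A.2 | p.1 == v])).

Record hytn := HyTN { nnodes : nat; arcs : seq hyperarc }.

(* well-formedness: tail in V, H_A nonempty subset of V \ {t_A},
   weights form a function on H_A (each head listed once) *)
Definition wf_arc (n : nat) (A : hyperarc) : bool :=
  [&& (tailA A < n)%N, headsA A != [::], all (fun h => (h < n)%N) (headsA A),
      uniq (headsA A) & tailA A \notin headsA A].
Definition wf (H : hytn) : bool := all (wf_arc (nnodes H)) (arcs H).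

Definition min_heads (A : hyperarc) (f : nat -> R) : R :=
  match headsA A with
  | [::] => 0
  | h :: hs => foldr (fun x acc => Num.min (f x) acc) (f h) hs
  end.

Definition feasible (H : hytn) (s : nat -> R) : Prop :=
  forall A, A \in arcs H ->
    min_heads A (fun v => s v - (weightA A v)%:~R) <= s (tailA A).

Definition consistent (H : hytn) : Prop := exists s : nat -> R, feasible H s.

(* |A| = |H_A u {t_A}| = |H_A| + 1, m = sum_A |A|,
   W = max_A max_{h in H_A} |w_A(h)| *)
Definition msize (H : hytn) : nat := \sum_(A <- arcs H) (size (headsA A)).+1.
Definition Wmax (H : hytn) : nat :=
  \max_(A <- arcs H) \max_(p <- A.2) `|p.2|%N.

(* Cycles.  A hyperarc subset C is given by a list of (distinct)       *)
(* indices into arcs H; S is a list of distinct nodes.                 *)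

Definition arcAt (H : hytn) (i : nat) : hyperarc := nth (0%N, [::]) (arcs H) i.

Definition aof (H : hytn) (C : seq nat) (v : nat) : nat :=
  head 0%N [seq i <- C | tailA (arcAt H i) == v].

Definition is_cycle (H : hytn) (S C : seq nat) : Prop :=
  [/\ [&& uniq S, uniq C & all (fun i => (i < size (arcs H))%N) C], S != [::],
      (forall v, v \in S <->
         exists i, i \in C /\ ((v == tailA (arcAt H i)) || (v \in headsA (arcAt H i))))
    & (forall v, v \in S -> count (fun i => tailA (arcAt H i) == v) C = 1%N)].

Definition cyclic_seq (H : hytn) (S C : seq nat) (vs : seq nat) : Prop :=
  [/\ (1 < size vs)%N, all (fun v => v \in S) vs,
      (forall t, (t.+1 < size vs)%N ->
         nth 0%N vs t.+1 \in headsA (arcAt H (aof H C (nth 0%N vs t)))),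
      nth 0%N vs (size vs).-1 = nth 0%N vs 0
    & uniq (take (size vs).-1 vs)].

Definition cyc_weight (H : hytn) (C : seq nat) (vs : seq nat) : int :=
  \sum_(0 <= t < (size vs).-1)
     weightA (arcAt H (aof H C (nth 0%N vs t))) (nth 0%N vs t.+1).

Definition is_negative_cycle (H : hytn) (S C : seq nat) : Prop :=
  is_cycle H S C /\
  (forall vs, cyclic_seq H S C vs -> cyc_weight H C vs < 0).

(* Model of computation: unit-cost RAM with additive operations        *)
(* (memory cells indexed by nat holding unbounded integers, direct and *)
(* indirect addressing, addition, subtraction, comparison jumps).      *)

Inductive instr : Type :=
| IConst of nat & int
| IAdd of nat & nat & nat
| ISub of nat & nat & nat
| ILoad of nat & nat
| IStore of nat & nat
| IJlt of nat & nat & nat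
| IJmp of nat
| IHalt.

Definition program := seq instr.
Definition memory := nat -> int.
Definition config := (nat * memory)%type.

Definition upd (M : memory) (a : nat) (z : int) : memory :=
  fun x => if x == a then z else M x.

Definition halted (P : program) (c : config) : bool :=
  match nth IHalt P c.1 with IHalt => true | _ => false end.

Definition step (P : program) (c : config) : config :=
  let: (pc, M) := c in
  match nth IHalt P pc with
  | IConst d z => (pc.+1, upd M d z)
  | IAdd d a b => (pc.+1, upd M d (M a + M b))
  | ISub d a b => (pc.+1, upd M d (M a - M b))
  | ILoad d a => (pc.+1, upd M d (M `|M a|%N))
  | IStore d a => (pc.+1, upd M `|M d|%N (M a))
  | IJlt a b l => (if M a < M b then l else pc.+1, M)
  | IJmp l => (l, M)
  | IHalt => (pc, M)
  end.

Definition halts_within (P : program) (c : config) (k : nat) (M' : memory) : Prop :=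
  exists2 t, (t <= k)%N & halted P (iter t (step P) c) /\ (iter t (step P) c).2 = M'.

Definition enc_arc (A : hyperarc) : seq int :=
  (tailA A)%:Z :: (size A.2)%:Z :: flatten [seq [:: p.1%:Z; p.2] | p <- A.2].
Definition encode (H : hytn) : seq int :=
  (nnodes H)%:Z :: (size (arcs H))%:Z :: flatten (map enc_arc (arcs H)).
Definition init (H : hytn) : config := (0%N, fun a => nth 0 (encode H) a).

(* time bound (|V| + |A|) m W; we use max(W,1) and add |V| + 1 so that the
   bound is meaningful for degenerate inputs (W = 0 or m = 0) *)
Definition tbound (H : hytn) : nat :=
  ((nnodes H + size (arcs H)) * msize H * maxn (Wmax H) 1 + nnodes H + 1)%N.

Definition out_bool (M : memory) : bool := M 0%N != 0.
Definition out_sched (M : memory) : nat -> int := M.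
Definition out_S (M : memory) : seq nat :=
  [seq `|M i.+1|%N | i <- iota 0 `|M 0%N|%N].
Definition out_C (M : memory) : seq nat :=
  let k := `|M 0%N|%N in
  [seq `|M (k + 2 + i)%N|%N | i <- iota 0 `|M k.+1|%N].

(* Main.v *)
Require Import Defs.
From Stdlib Require Import Reals.
From HB Require Import structures.
From mathcomp Require Import all_boot all_order all_algebra.
From mathcomp Require Import Rstruct zify.
Import Order.TTheory GRing.Theory Num.Theory.
Set Implicit Arguments. Unset Strict Implicit. Unset Printing Implicit Defensive.
Local Open Scope ring_scope.

(** Start from the zero schedule and lift by one the tail of a violated hyperarc
    until none is left or some value exceeds |A| W.  If nothing is violated the
    schedule is feasible.  Otherwise, for a lifted node u let a(u) be the arc which
    caused its last lift: then s(h) >= s(u) + w(h) for every head h of a(u), strictly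
    if h was lifted after u.  A value above |A| W forces a gap of width W among the
    at most |A| distinct positive values, so the nodes above the gap are closed
    under the heads of a; on each cycle of a the weights telescope to a negative
    number.  A feasible schedule would give, by following minimizing heads, a cycle
    of nonnegative weight inside any negative cycle.

    The running time is amortized: an arc keeps a pointer to a head that witnesses
    its constraint; the pointer only advances while the value of the tail is
    unchanged, so an arc A costs O(|A|) for each of the O(|A| W) values of its tail, and
    a lift of v pushes the arcs with head v on a stack. *)

(** * Structured programs with time credits *)

(** The theorem asks for literal machine programs, and the machine is hostile in three ways. The
    input fills memory from cell 0 on, so no register is free at the start. Node numbers may exceed
    the length of the input, so no fixed region is safe for output indexed by nodes. There is no
    multiplication. Hence the input is first moved above a base [B] larger than each of its entries,
    arrays are interleaved there, and [a * W] is obtained by repeated addition. Untouched memory is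
    zero, so the schedule and the list heads need no initialization, and |V| enters the running time
    only through the length of the output.

    The strict inequality on cycles comes from the times of the last lifts. These times exist only
    in the proof; no cell stores them. The gap of width [W] is not computed either: the program
    searches from the node that overflowed along the arcs [lifter], and the set above the gap serves
    only to prove that this search stays among lifted nodes. Since lifted nodes are tails, every
    bound is in terms of the number of arcs. *)

Inductive cmd (I : Type) : Type :=
| Skip
| Act of I
| Seq of cmd I & cmd I
| If of nat & nat & cmd I & cmd I
| While of nat & nat & cmd I.
Arguments Skip {I}.

Notation "c1 ;; c2" := (Seq c1 c2) (at level 60, right associativity).

Section Exec.
Variables (S I : Type) (reg : S -> nat -> int) (pre : I -> S -> Prop).
Variable act : I -> S -> S.

(** The semantics is generic because it is used at two levels: on raw memory cells and on the array
    language. At both levels each action and each test costs one unit, and the translations between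
    levels only lose constant factors. *)
Inductive exec : cmd I -> S -> nat -> S -> Prop :=
| ExSkip s : exec Skip s 0 s
| ExAct i s : pre i s -> exec (Act i) s 1 (act i s)
| ExSeq c1 c2 s s1 s2 t1 t2 : exec c1 s t1 s1 -> exec c2 s1 t2 s2 ->
    exec (c1 ;; c2) s (t1 + t2) s2
| ExIfT a b c1 c2 s s1 t : reg s a < reg s b -> exec c1 s t s1 ->
    exec (If a b c1 c2) s t.+1 s1
| ExIfF a b c1 c2 s s1 t : reg s b <= reg s a -> exec c2 s t s1 ->
    exec (If a b c1 c2) s t.+1 s1
| ExWhileT a b c s s1 s2 t1 t2 : reg s a < reg s b -> exec c s t1 s1 ->
    exec (While a b c) s1 t2 s2 -> exec (While a b c) s (t1 + t2).+1 s2
| ExWhileF a b c s : reg s b <= reg s a -> exec (While a b c) s 1 s.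

(* [k] is a number of time credits: [wp c s k Q] holds when [c] runs from [s]
   and [Q] holds of the final state and of the credits left.  Credits live in
   [int], so that overspending only shows as a negative balance in [Q]. *)
Definition wp (c : cmd I) (s : S) (k : int) (Q : S -> int -> Prop) : Prop :=
  exists t s', exec c s t s' /\ Q s' (k - t%:Z).

Lemma wp_skip s k (Q : S -> int -> Prop) : Q s k -> wp Skip s k Q.
Proof. by move=> HQ; exists 0%N, s; split; [constructor | rewrite subr0]. Qed.

Lemma wp_act i s k (Q : S -> int -> Prop) :
  pre i s -> Q (act i s) (k - 1) -> wp (Act i) s k Q.
Proof. by move=> Hp HQ; exists 1%N, (act i s); split => //; constructor. Qed.

Lemma wp_seq c1 c2 s k (Q : S -> int -> Prop) :
  wp c1 s k (fun s' k' => wp c2 s' k' Q) -> wp (c1 ;; c2) s k Q.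
Proof.
move=> [t1 [s1 [H1 [t2 [s2 [H2 HQ]]]]]]; exists (t1 + t2)%N, s2; split.
  exact: ExSeq H1 H2.
by rewrite PoszD opprD addrA.
Qed.

Lemma wp_act_seq i c s k (Q : S -> int -> Prop) :
  pre i s -> wp c (act i s) (k - 1) Q -> wp (Act i ;; c) s k Q.
Proof. by move=> Hp HQ; apply: wp_seq; apply: wp_act. Qed.

Lemma wp_if a b c1 c2 s k (Q : S -> int -> Prop) :
  (reg s a < reg s b -> wp c1 s (k - 1) Q) ->
  (reg s b <= reg s a -> wp c2 s (k - 1) Q) -> wp (If a b c1 c2) s k Q.
Proof.
move=> HT HF; case: (ltP (reg s a) (reg s b)) => Hab.
  have [t [s' [He HQ]]] := HT Hab; exists t.+1, s'; split; first exact: ExIfT.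
  by rewrite -addn1 PoszD (addrC (Posz t)) opprD addrA.
have [t [s' [He HQ]]] := HF Hab; exists t.+1, s'; split; first exact: ExIfF.
by rewrite -addn1 PoszD (addrC (Posz t)) opprD addrA.
Qed.

(* No separate variant is needed: each iteration spends a credit and the
   invariant keeps the balance nonnegative. *)
Lemma wp_while a b c (Inv : S -> int -> Prop) s k (Q : S -> int -> Prop) :
  Inv s k -> (forall s k, Inv s k -> 0 <= k) ->
  (forall s k, Inv s k -> reg s a < reg s b -> wp c s (k - 1) Inv) ->
  (forall s k, Inv s k -> reg s b <= reg s a -> Q s (k - 1)) ->
  wp (While a b c) s k Q.
Proof.
move=> Hs H0 Hb Hq.
have [n Hn] : exists n : nat, k <= n%:Z by exists `|k|%N; lia.
elim: n s k Hs Hn => [|n IH] s k Hs Hn.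
  case: (ltP (reg s a) (reg s b)) => Hab.
    have [t [s1 [He HI]]] := Hb _ _ Hs Hab.
    by have := H0 _ _ HI; lia.
  by exists 1%N, s; split; [apply: ExWhileF | apply: Hq].
case: (ltP (reg s a) (reg s b)) => Hab.
  have [t [s1 [He HI]]] := Hb _ _ Hs Hab.
  have [|t2 [s2 [He2 HQ]]] := IH _ _ HI; first lia.
  exists (t + t2).+1, s2; split; first exact: ExWhileT He He2.
  by congr (Q _ _): HQ; lia.
by exists 1%N, s; split; [apply: ExWhileF | apply: Hq].
Qed.

End Exec.

Definition basic (i : instr) : bool :=
  match i with IJlt _ _ _ | IJmp _ | IHalt => false | _ => true end.

Definition ract (i : instr) (M : memory) : memory :=
  match i with
  | IConst d z => upd M d z
  | IAdd d a b => upd M d (M a + M b)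
  | ISub d a b => upd M d (M a - M b)
  | ILoad d a => upd M d (M `|M a|%N)
  | IStore d a => upd M `|M d|%N (M a)
  | _ => M
  end.

Notation rcmd := (cmd instr).
Notation rexec := (exec (fun M : memory => M) (fun i _ => basic i) ract).
Notation rwp := (wp (fun M : memory => M) (fun i _ => basic i) ract).

Fixpoint csize (c : rcmd) : nat :=
  match c with
  | Skip => 0
  | Act _ => 1
  | Seq c1 c2 => csize c1 + csize c2
  | If _ _ c1 c2 => (csize c2 + csize c1).+2
  | While _ _ c => (csize c).+3
  end.

(** Jump targets are absolute, so the code depends on the address [o] at which it will lie. The
    branch [c2] comes first because the conditional jump falls through when its test fails. *)
Fixpoint asm (o : nat) (c : rcmd) : program :=
  match c with
  | Skip => [::]
  | Act i => [:: i]
  | Seq c1 c2 => asm o c1 ++ asm (o + csize c1) c2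
  | If a b c1 c2 =>
      IJlt a b (o + (csize c2).+2) :: asm o.+1 c2 ++
      IJmp (o + (csize c2 + csize c1).+2) :: asm (o + (csize c2).+2) c1
  | While a b c =>
      [:: IJlt a b o.+2, IJmp (o + (csize c).+3) & rcons (asm o.+2 c) (IJmp o)]
  end.

Lemma size_asm o c : size (asm o c) = csize c.
Proof.
elim: c o => //= [c1 IH1 c2 IH2|a b c1 IH1 c2 IH2|a b c IH] o.
- by rewrite size_cat IH1 IH2.
- by rewrite size_cat /= IH1 IH2 addnS.
- by rewrite size_rcons IH.
Qed.

(** The factor 2 pays for the unconditional jumps: at most one accompanies each test. The
    surrounding code [P1], [P2] is arbitrary so that the induction hypothesis applies to a fragment
    in its place. *)
Lemma asm_run (P1 P2 : program) c M t M' :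
  rexec c M t M' ->
  exists2 n, (n <= 2 * t)%N &
    iter n (step (P1 ++ asm (size P1) c ++ P2)) (size P1, M)
    = (size P1 + csize c, M')%N.
Proof.
move=> He; elim: He P1 P2 => {c M t M'}.
- by move=> M P1 P2; exists 0%N => //=; rewrite addn0.
- move=> i M Hb P1 P2; exists 1%N => //=.
  by rewrite nth_cat ltnn subnn /= addn1; case: i Hb.
- move=> c1 c2 M M1 M2 t1 t2 _ IH1 _ IH2 P1 P2 /=.
  have [n1 Hn1 E1] := IH1 P1 (asm (size P1 + csize c1) c2 ++ P2).
  have [n2 Hn2 E2] := IH2 (P1 ++ asm (size P1) c1) P2.
  exists (n2 + n1)%N; first lia.
  rewrite -[(_ ++ _) ++ P2]catA iterD E1.
  by move: E2; rewrite size_cat size_asm -!catA addnA.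
- move=> a b c1 c2 M M1 t Hab _ IH P1 P2 /=.
  have [n Hn E] := IH (P1 ++ IJlt a b (size P1 + (csize c2).+2) ::
     asm (size P1).+1 c2 ++
     [:: IJmp (size P1 + (csize c2 + csize c1).+2)]) P2.
  exists n.+1; first lia.
  rewrite iterSr /= nth_cat ltnn subnn /= Hab.
  move: E; rewrite size_cat /= size_cat size_asm /= addn1 -!catA /= -!catA /=.
  by rewrite addnS addnS => ->; congr pair; lia.
- move=> a b c1 c2 M M1 t Hab _ IH P1 P2 /=.
  have [n Hn E] := IH (rcons P1 (IJlt a b (size P1 + (csize c2).+2)))
     (IJmp (size P1 + (csize c2 + csize c1).+2)
        :: asm (size P1 + (csize c2).+2) c1 ++ P2).
  exists n.+2; first lia.
  rewrite iterS iterSr /= nth_cat ltnn subnn /= ltNge Hab /=.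
  move: E; rewrite size_rcons cat_rcons -!catA /= => ->.
  rewrite /= nth_cat ltnNge ltnW ?addSn ?ltnS ?leq_addr //= subSn ?leq_addr //.
  rewrite /= -addnS addKn nth_cat size_asm ltnn subnn /=.
  by congr pair.
- move=> a b c M M1 M2 t1 t2 Hab _ IH1 _ IH2 P1 P2 /=.
  have [n1 Hn1 E1] := IH1 (P1 ++ [:: IJlt a b (size P1).+2;
     IJmp (size P1 + (csize c).+3)]) (IJmp (size P1) :: P2).
  have [n2 Hn2 E2] := IH2 P1 P2.
  exists (n2 + n1.+2)%N; first lia.
  rewrite iterD iterS iterSr /= nth_cat ltnn subnn /= Hab.
  move: E1; rewrite size_cat /= addn2 -!catA /= cat_rcons => ->.
  rewrite /= nth_cat ltnNge !addSn /= -!addnS leq_addr /=.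
  rewrite addKn /= nth_cat size_asm ltnn subnn /=.
  by move: E2 => /=; rewrite cat_rcons.
- move=> a b c M Hab P1 P2 /=.
  exists 2%N => //=.
  rewrite nth_cat ltnn subnn /= ltNge Hab /=.
  by rewrite nth_cat ltnNge leqnSn /= subSn // subnn /=.
Qed.

(** The code contains no halting instruction: the program counter runs off its end, where the
    default of [nth] is [IHalt]. *)
Lemma asm_halts c M t M' k :
  rexec c M t M' -> (2 * t <= k)%N -> halts_within (asm 0 c) (0%N, M) k M'.
Proof.
move=> He Hk; have [n Hn E] := asm_run [::] [::] He.
rewrite /= cats0 in E; exists n; first exact: leq_trans Hn Hk.
by rewrite E /halted /= nth_default ?size_asm.
Qed.

(** * A language with arrays *)

Inductive hop : Type :=
| HConst of nat & int
| HAdd of nat & nat & nat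
| HSub of nat & nat & nat
| HGet of nat & nat & nat
| HPut of nat & nat & nat.

Record hst := HSt { hreg : nat -> int; harr : nat -> nat -> int }.

Definition upd2 (A : nat -> nat -> int) (f i : nat) (z : int) :=
  fun g => if g == f then upd (A f) i z else A g.

(** The machine forms [B + 16 i + f] first and takes the absolute value of the sum, so a negative
    index would reach a cell other than the one for the absolute value of [i]. *)
Definition hpre (i : hop) (s : hst) : Prop :=
  match i with
  | HGet _ _ i | HPut _ i _ => 0 <= hreg s i
  | _ => True
  end.

Definition hact (i : hop) (s : hst) : hst :=
  let: HSt R A := s in
  match i with
  | HConst d z => HSt (upd R d z) A
  | HAdd d a b => HSt (upd R d (R a + R b)) A
  | HSub d a b => HSt (upd R d (R a - R b)) A
  | HGet d f i => HSt (upd R d (A f `|R i|%N)) A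
  | HPut f i a => HSt R (upd2 A f `|R i|%N (R a))
  end.

Notation hcmd := (cmd hop).
Notation hexec := (exec hreg hpre hact).
Notation hwp := (wp hreg hpre hact).

(* Cell 2 holds the base B; the array entry f[i] lives in cell B + 16 i + f,
   so sixteen unbounded arrays are interleaved.  Cells 0 and 1 are scratch, and
   register r of the array language is cell r for 3 <= r < 32. *)
Definition nregs : nat := 32.

Definition rep (B : nat) (M : memory) (s : hst) : Prop :=
  [/\ M 2%N = B%:Z, (nregs <= B)%N,
      (forall r, (2 < r < nregs)%N -> M r = hreg s r) &
      (forall f i, (f < 16)%N -> M (B + 16 * i + f)%N = harr s f i)].

Definition isreg (r : nat) := (2 < r < nregs)%N.

Definition hop_ok (i : hop) : bool :=
  match i with
  | HConst d _ => isreg d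
  | HAdd d a b | HSub d a b => [&& isreg d, isreg a & isreg b]
  | HGet d f i => [&& isreg d, isreg i & (f < 16)%N]
  | HPut f i a => [&& isreg i, isreg a & (f < 16)%N]
  end.

Fixpoint hcmd_ok (c : hcmd) : bool :=
  match c with
  | Skip => true
  | Act i => hop_ok i
  | c1 ;; c2 => hcmd_ok c1 && hcmd_ok c2
  | If a b c1 c2 => [&& isreg a, isreg b, hcmd_ok c1 & hcmd_ok c2]
  | While a b c => [&& isreg a, isreg b & hcmd_ok c]
  end.

(** Multiplication by sixteen is done by four doublings. *)
Definition addr (f i : nat) : rcmd :=
  Act (IAdd 0 i i) ;; Act (IAdd 0 0 0) ;; Act (IAdd 0 0 0) ;; Act (IAdd 0 0 0) ;;
  Act (IAdd 0 0 2) ;; Act (IConst 1 f%:Z) ;; Act (IAdd 0 0 1).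

Definition expand (i : hop) : rcmd :=
  match i with
  | HConst d z => Act (IConst d z)
  | HAdd d a b => Act (IAdd d a b)
  | HSub d a b => Act (ISub d a b)
  | HGet d f i => addr f i ;; Act (ILoad d 0)
  | HPut f i a => addr f i ;; Act (IStore 0 a)
  end.

Fixpoint hcomp (c : hcmd) : rcmd :=
  match c with
  | Skip => Skip
  | Act i => expand i
  | c1 ;; c2 => hcomp c1 ;; hcomp c2
  | If a b c1 c2 => If a b (hcomp c1) (hcomp c2)
  | While a b c => While a b (hcomp c)
  end.

Lemma upd_ne (M : memory) d z x : x != d -> upd M d z x = M x.
Proof. by rewrite /upd => /negPf ->. Qed.

Lemma upd_eq (M : memory) d z : upd M d z d = z.
Proof. by rewrite /upd eqxx. Qed.

Lemma rwp_addr B f i M k (Q : memory -> int -> Prop) :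
  M 2%N = B%:Z -> (2 < i)%N -> 0 <= M i ->
  (forall M', M' 0%N = (B + 16 * `|M i|%N + f)%N%:Z ->
     (forall x, (1 < x)%N -> M' x = M x) -> Q M' (k - 7)) ->
  rwp (addr f i) M k Q.
Proof.
move=> HB Hi Hi0 HQ; rewrite /addr.
do 6!(apply: wp_act_seq => //); apply: wp_act => //.
have Hn : (i == 0)%N = false by case: i Hi {Hi0 HQ}.
set M' := ract _ _; have -> : k - 1 - 1 - 1 - 1 - 1 - 1 - 1 = k - 7 by lia.
apply: HQ; rewrite {}/M' /= /upd /=.
  by rewrite HB; lia.
by case=> [|[|x]].
Qed.

Lemma rep_reg B M s d z A' M' :
  rep B M s -> isreg d -> (forall x, (1 < x)%N -> M' x = upd M d z x) ->
  A' = harr s -> rep B M' (HSt (upd (hreg s) d z) A').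
Proof.
move=> [H2 HB HR HA] Hd HM ->; move: (Hd); rewrite /isreg /nregs in HB * => Hd'.
split => //=.
- by rewrite HM // upd_ne //; lia.
- move=> r Hr; rewrite HM; last by lia.
  by rewrite /upd; case: eqP => // _; apply: HR.
- move=> f i Hf; rewrite HM; last by lia.
  by rewrite upd_ne ?HA //; lia.
Qed.

Lemma rep_put B M s f i z M' :
  rep B M s -> (f < 16)%N ->
  (forall x, (1 < x)%N -> M' x = upd M (B + 16 * i + f)%N z x) ->
  rep B M' (HSt (hreg s) (upd2 (harr s) f i z)).
Proof.
move=> [H2 HB HR HA] Hf HM; rewrite /nregs in HB HR *.
split => //=.
- by rewrite HM // upd_ne //; lia.
- rewrite /nregs => r Hr; rewrite HM; last by lia.
  by rewrite upd_ne ?HR //; lia.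
- move=> g j Hg; rewrite HM; last by lia.
  rewrite /upd2 /upd; case: (eqVneq g f) => [->|Hgf].
    case: (eqVneq j i) => [->|Hji]; first by rewrite eqxx.
    by rewrite ifF ?HA //; apply/negbTE; lia.
  by rewrite ifF ?HA //; apply/negbTE; lia.
Qed.

Lemma expand_sim B i M s :
  rep B M s -> hop_ok i -> hpre i s ->
  exists t M', [/\ rexec (expand i) M t M', (t <= 8)%N & rep B M' (hact i s)].
Proof.
case: s => R A Hrep; have [H2 HB HR HA] := Hrep; rewrite /= in HR HA.
case: i => [d z|d a b|d a b|d f i|f i a] /=.
- move=> Hd _; do 2!eexists; split; [by apply: ExAct| by [] |].
  by apply: (rep_reg Hrep Hd).
- case/and3P=> Hd Ha Hb _; do 2!eexists; split; [by apply: ExAct| by [] |].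
  by apply: (rep_reg Hrep Hd) => //= x _; rewrite (HR a) // (HR b).
- case/and3P=> Hd Ha Hb _; do 2!eexists; split; [by apply: ExAct| by [] |].
  by apply: (rep_reg Hrep Hd) => //= x _; rewrite (HR a) // (HR b).
- case/and3P=> Hd Hi Hf Hi0; have Hi2 : (2 < i)%N by case/andP: Hi.
  have := @rwp_addr B f i M 0 (fun M' k => k = -7 /\
    M' 0%N = (B + 16 * `|M i|%N + f)%N%:Z /\ forall x, (1 < x)%N -> M' x = M x).
  case=> //; first by rewrite HR.
  move=> t [M1 [E1 [Ht [E0 E]]]].
  exists (t + 1)%N, (ract (ILoad d 0) M1); split; [|lia|].
    by apply: ExSeq E1 _; apply: ExAct.
  apply: (rep_reg Hrep Hd) => //= x Hx.
  rewrite E0 absz_nat [M1 (_ + _)%N]E; last by move: HB; rewrite /nregs; lia.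
  by rewrite HA // -HR // /upd; case: eqP => // _; apply: E.
- case/and3P=> Hi Ha Hf Hi0; have Hi2 : (2 < i)%N by case/andP: Hi.
  have := @rwp_addr B f i M 0 (fun M' k => k = -7 /\
    M' 0%N = (B + 16 * `|M i|%N + f)%N%:Z /\ forall x, (1 < x)%N -> M' x = M x).
  case=> //; first by rewrite HR.
  move=> t [M1 [E1 [Ht [E0 E]]]].
  exists (t + 1)%N, (ract (IStore 0 a) M1); split; [|lia|].
    by apply: ExSeq E1 _; apply: ExAct.
  have Ha2 : (2 < a)%N by case/andP: Ha.
  apply: (rep_put Hrep Hf) => //= x Hx.
  rewrite E0 absz_nat [M1 a]E ?(HR a) //; last exact: ltnW.
  rewrite -(HR i) //.
  by rewrite /upd; case: eqP => // _; apply: E.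
Qed.

(** The factor 8 is the cost of an array access: seven instructions for the address and one for the
    transfer. *)
Lemma hcomp_sim B c s t s' : hexec c s t s' -> hcmd_ok c ->
  forall M, rep B M s ->
  exists t' M', [/\ rexec (hcomp c) M t' M', (t' <= 8 * t)%N & rep B M' s'].
Proof.
have reg_eq a M s0 : isreg a -> rep B M s0 -> M a = hreg s0 a.
  by move=> Ha [_ _ HR _]; apply: HR.
elim=> {c s t s'} /=.
- by move=> s _ M HM; exists 0%N, M; split => //; constructor.
- by move=> i s Hp Hi M HM; apply: expand_sim.
- move=> c1 c2 s s1 s2 t1 t2 _ IH1 _ IH2 /andP[Hc1 Hc2] M HM.
  have [u1 [M1 [E1 L1 R1]]] := IH1 Hc1 _ HM.
  have [u2 [M2 [E2 L2 R2]]] := IH2 Hc2 _ R1.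
  exists (u1 + u2)%N, M2; split => //; [exact: ExSeq E1 E2 | lia].
- move=> a b c1 c2 s s1 t Hab _ IH /and4P[Ha Hb Hc1 _] M HM.
  have [u [M1 [E1 L1 R1]]] := IH Hc1 _ HM.
  exists u.+1, M1; split => //; last by lia.
  by apply: ExIfT E1; rewrite (reg_eq a M s) // (reg_eq b M s).
- move=> a b c1 c2 s s1 t Hab _ IH /and4P[Ha Hb _ Hc2] M HM.
  have [u [M1 [E1 L1 R1]]] := IH Hc2 _ HM.
  exists u.+1, M1; split => //; last by lia.
  by apply: ExIfF E1; rewrite (reg_eq a M s) // (reg_eq b M s).
- move=> a b c s s1 s2 t1 t2 Hab _ IH1 _ IH2 /and3P[Ha Hb Hc] M HM.
  have [u1 [M1 [E1 L1 R1]]] := IH1 Hc _ HM.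
  have [u2 [M2 [E2 L2 R2]]] := IH2 (introT and3P (And3 Ha Hb Hc)) _ R1.
  exists (u1 + u2).+1, M2; split => //; last by lia.
  by apply: ExWhileT E1 E2; rewrite (reg_eq a M s) // (reg_eq b M s).
- move=> a b c s Hab /and3P[Ha Hb Hc] M HM.
  exists 1%N, M; split => //.
  by apply: ExWhileF; rewrite (reg_eq a M s) // (reg_eq b M s).
Qed.

(** * Loading the input and writing the output *)

Section Encoding.
Variable l : seq hyperarc.
Definition karc (i : nat) : nat := size (nth (0%N, [::]) l i).2.
Definition off (i : nat) : nat := \sum_(j < i) karc j.

Lemma off0 : off 0 = 0%N. Proof. by rewrite /off big_ord0. Qed.
Lemma offS i : off i.+1 = (off i + karc i)%N.
Proof. by rewrite /off big_ord_recr. Qed.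

Lemma off_mono i j : (i <= j)%N -> (off i <= off j)%N.
Proof.
elim: j => [|j IH]; first by rewrite leqn0 => /eqP ->.
rewrite leq_eqVlt => /predU1P[-> //|/IH Hi]; apply: leq_trans Hi _.
by rewrite offS leq_addr.
Qed.
End Encoding.

Lemma off_cons A l i : off (A :: l) i.+1 = (size A.2 + off l i)%N.
Proof. by rewrite /off big_ord_recl. Qed.

Lemma size_flat_pairs (s : seq (nat * int)) :
  size (flatten [seq [:: p.1%:Z; p.2] | p <- s]) = (2 * size s)%N.
Proof. by elim: s => //= p s ->; lia. Qed.

Lemma size_enc_arc A : size (enc_arc A) = (2 + 2 * size A.2)%N.
Proof. by rewrite /enc_arc /= size_flat_pairs. Qed.

Lemma nth_flat_pairs (s : seq (nat * int)) q : (q < size s)%N ->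
  nth 0 (flatten [seq [:: p.1%:Z; p.2] | p <- s]) (2 * q) = (nth (0%N, 0) s q).1%:Z /\
  nth 0 (flatten [seq [:: p.1%:Z; p.2] | p <- s]) (2 * q).+1 = (nth (0%N, 0) s q).2.
Proof.
elim: s q => // p s IH; case=> [|q] Hq; first by rewrite muln0.
by rewrite mulnS /=; apply: IH.
Qed.

Definition encb (l : seq hyperarc) : seq int := flatten (map enc_arc l).

Lemma encb_cons A l : encb (A :: l) = enc_arc A ++ encb l.
Proof. by []. Qed.

Lemma nth_encb_shift A l i x :
  nth 0 (encb (A :: l)) (2 * i.+1 + 2 * off (A :: l) i.+1 + x)
  = nth 0 (encb l) (2 * i + 2 * off l i + x).
Proof.
rewrite encb_cons off_cons nth_cat size_enc_arc ifF; last first.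
  by apply/negbTE; rewrite -leqNgt; lia.
by congr nth; lia.
Qed.

(** Each earlier arc contributes two header cells and two cells per head, which places the block of
    arc [i] at [2 * i + 2 * off l i]. *)
Lemma nth_encb l i x : (i < size l)%N -> (x < 2 + 2 * karc l i)%N ->
  nth 0 (encb l) (2 * i + 2 * off l i + x)
  = nth 0 (enc_arc (nth (0%N, [::]) l i)) x.
Proof.
elim: l i => // A l IH [|i] Hi Hx.
  by rewrite off0 encb_cons nth_cat size_enc_arc /= ifT.
by rewrite nth_encb_shift IH.
Qed.

Lemma size_encb l : size (encb l) = (2 * size l + 2 * off l (size l))%N.
Proof.
elim: l => [|A l IH]; first by rewrite off0.
by rewrite encb_cons size_cat size_enc_arc IH [size (A :: l)]/= off_cons; lia.
Qed.

Definition inp (H : hytn) (x : nat) : int := nth 0 (encode H) x.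
Arguments inp : simpl never.

Section Input.
Variable H : hytn.
Let l := arcs H.
Let a := size (arcs H).
Notation enc := (inp H).

Lemma enc_pos i x : (i < a)%N -> (x < 2 + 2 * karc l i)%N ->
  enc (2 + 2 * i + 2 * off l i + x) = nth 0 (enc_arc (nth (0%N, [::]) l i)) x.
Proof. by move=> Hi Hx; rewrite -nth_encb // /inp /encode -!addnA. Qed.

Lemma size_encode : size (encode H) = (2 + 2 * a + 2 * off l a)%N.
Proof. by rewrite /encode /= -/(encb l) size_encb. Qed.

Lemma enc_tail i : (i < a)%N ->
  enc (2 + 2 * i + 2 * off l i) = (tailA (nth (0%N, [::]) l i))%:Z.
Proof. by move=> Hi; rewrite -[X in enc X]addn0 enc_pos. Qed.

Lemma enc_karc i : (i < a)%N ->
  enc (3 + 2 * i + 2 * off l i) = (karc l i)%:Z.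
Proof.
move=> Hi; have -> : (3 + 2 * i + 2 * off l i = 2 + 2 * i + 2 * off l i + 1)%N by lia.
by rewrite enc_pos.
Qed.

Lemma enc_entry i q : (i < a)%N -> (q < karc l i)%N ->
  enc (4 + 2 * i + 2 * (off l i + q))
    = (nth (0%N, 0) (nth (0%N, [::]) l i).2 q).1%:Z /\
  enc (5 + 2 * i + 2 * (off l i + q)) = (nth (0%N, 0) (nth (0%N, [::]) l i).2 q).2.
Proof.
move=> Hi Hq.
have -> : (4 + 2 * i + 2 * (off l i + q) = 2 + 2 * i + 2 * off l i + (2 * q).+2)%N by lia.
have -> : (5 + 2 * i + 2 * (off l i + q) = 2 + 2 * i + 2 * off l i + (2 * q).+3)%N by lia.
rewrite !enc_pos //; try lia.
by rewrite /enc_arc /= ; apply: nth_flat_pairs.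
Qed.

Lemma enc_end x : (size (encode H) <= x)%N -> enc x = 0.
Proof. exact: nth_default. Qed.

Hypothesis wfH : wf H.

Lemma wf_nth i : (i < a)%N -> wf_arc (nnodes H) (arcAt H i).
Proof. by move=> Hi; move/allP: wfH => ->//; rewrite /arcAt mem_nth. Qed.

Lemma karc_gt0 i : (i < a)%N -> (0 < karc l i)%N.
Proof.
move=> Hi; have /and5P[_ H1 _ _ _] := wf_nth Hi.
by move: H1; rewrite /karc /headsA /arcAt; case: (_.2).
Qed.

(** Head counts are positive in a well-formed network and memory past the input is zero. The sign of
    this one cell therefore tells whether an arc [i] exists, which is the loop test both of
    [find_end] and of the parser. *)
Lemma enc_karc_le i : (i <= a)%N ->
  0 <= enc (3 + 2 * i + 2 * off l i) /\
  ((0 < enc (3 + 2 * i + 2 * off l i)) = (i < a)%N).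
Proof.
rewrite leq_eqVlt => /predU1P[->|Hi].
  by rewrite ltnn enc_end ?lexx ?ltxx // size_encode; lia.
by rewrite enc_karc // Hi; have := karc_gt0 Hi; lia.
Qed.

(* Cells 0 and 1 hold |V| and |A|, which are redundant: the arc list ends
   at the first arc with no heads.  They serve as the only two free registers
   until the end of the input is known. *)
Definition find_end : rcmd :=
  Act (IConst 0 3) ;; Act (ILoad 1 0) ;; Act (IAdd 1 1 0) ;;
  While 0 1 (Act (ISub 1 1 0) ;; Act (IAdd 0 0 1) ;; Act (IAdd 0 0 1) ;;
    Act (IConst 1 2) ;; Act (IAdd 0 0 1) ;; Act (ILoad 1 0) ;; Act (IAdd 1 1 0)).

(** Cell 1 holds the pointer of cell 0 plus the head count found there, so comparing the two cells
    tests the count against zero without a cell that holds zero. An arc costs seven instructions and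
    one test. *)
Lemma find_endP k (Q : memory -> int -> Prop) : (8 * a + 4 <= k)%N ->
  (forall (M : memory) (k' : int), M 0%N = (size (encode H)).+1%:Z ->
     (forall x, (1 < x)%N -> M x = enc x) -> k%:Z - (8 * a + 4)%:Z <= k' -> Q M k') ->
  rwp find_end enc k Q.
Proof.
move=> Hk HQ; rewrite /find_end; do 3!apply: wp_act_seq => //.
apply: (@wp_while _ _ _ _ _ _ _ _ (fun M k' => exists i, [/\ (i <= a)%N,
   M 0%N = (3 + 2 * i + 2 * off l i)%N%:Z,
   M 1%N = M 0%N + enc (3 + 2 * i + 2 * off l i),
   (forall x, (1 < x)%N -> M x = enc x) &
   k%:Z - (8 * a + 4)%:Z + (8 * (a - i) + 1)%:Z <= k'])).
- exists 0%N; split => //.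
  + by rewrite off0.
  + by rewrite /upd /= off0 addrC.
  + by move=> [|[|x]].
  + lia.
- by move=> M k' [i [Hi _ _ _ Hk']]; lia.
- move=> M k' [i [Hi H0 H1 Hx Hk']]; rewrite H1 H0 => Hlt.
  have [Hge Hia] := enc_karc_le Hi.
  have {}Hia : (i < a)%N by lia.
  do 6!apply: wp_act_seq => //; apply: wp_act => //.
  have E0 : `|(M 0%N + (M 1%N - M 0%N) + (M 1%N - M 0%N) + 2)%R|%N
     = (3 + 2 * i.+1 + 2 * off l i.+1)%N.
    by rewrite H1 H0 offS enc_karc //; lia.
  rewrite /= /upd /= E0 /=; exists i.+1; split => //.
  + by rewrite -E0 H1 H0 enc_karc //; lia.
  + by rewrite addrC [M (_ + _)%N]Hx //; lia.
  + by move=> [|[|x]] // Hx2; apply: Hx.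
  + lia.
- move=> M k' [i [Hi H0 H1 Hx Hk']]; rewrite H1 H0 => Hle.
  have [Hge Hia] := enc_karc_le Hi.
  have Ea : i = a by lia.
  apply: HQ => //; last by lia.
  by rewrite H0 Ea size_encode.
Qed.
End Input.

(** * Freeing the register cells and moving the input above the base *)

Fixpoint saves (d n : nat) : rcmd :=
  if n is n'.+1 then Act (IStore 0 d) ;; Act (IAdd 0 0 1) ;; saves d.+1 n' else Skip.

(** The code is unrolled because source cells are then addressed directly: a loop would need a
    second pointer, while only cells 0 and 1 are free. *)
Lemma savesP c d n M k (Q : memory -> int -> Prop) :
  (n <= c)%N -> (1 < d)%N -> M 0%N = (c + d)%N%:Z -> M 1%N = 1 ->
  (forall M' : memory, M' 0%N = (c + d + n)%N%:Z ->
    (forall x, (0 < x)%N ->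
       M' x = if (c + d <= x < c + d + n)%N then M (x - c)%N else M x) ->
    Q M' (k - (2 * n)%:Z)) ->
  rwp (saves d n) M k Q.
Proof.
elim: n d M k => [|n IH] d M k Hc Hd H0 H1 HQ /=.
  apply: wp_skip; have := HQ M; rewrite subr0 addn0; apply => // x Hx.
  by rewrite ifF //; apply/negbTE; lia.
do 2!apply: wp_act_seq => //.
rewrite /= /upd /= H0 absz_nat H1.
have Hcd : (0%N == (c + d)%N) = false by apply/negbTE; lia.
have Hcd1 : (1%N == (c + d)%N) = false by apply/negbTE; lia.
have Hd0 : (d == (c + d)%N) = false by apply/negbTE; lia.
rewrite Hcd Hcd1.
apply: IH => //=; rewrite ?Hcd1 //; try lia.
move=> M' H0' Hx.
have -> : k - 1 - 1 - (2 * n)%:Z = k - (2 * n.+1)%:Z by lia.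
apply: HQ; first by rewrite H0'; congr Posz; lia.
move=> x Hx0; rewrite Hx //.
have [->|Hne] := eqVneq x (c + d)%N.
  have -> : (c + d.+1 <= c + d < c + d.+1 + n)%N = false by lia.
  have -> : ((c + d)%N == 0%N) = false by lia.
  have -> : (c + d <= c + d < c + d + n.+1)%N by lia.
  by rewrite addKn.
have -> : (x == 0%N) = false by lia.
have -> : (c + d.+1 <= x < c + d.+1 + n)%N = (c + d <= x < c + d + n.+1)%N by lia.
case: ifP => // Hr.
have -> : ((x - c)%N == 0%N) = false by lia.
by have -> : ((x - c)%N == (c + d)%N) = false by lia.
Qed.

(** Adding all positive entries to the end of the used memory gives a base beyond every entry, hence
    beyond every node number. Output cells, which are indexed by nodes, thus stay below the
    arrays. *)
Definition bound_loop : rcmd :=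
  While 4 0 (Act (ILoad 5 4) ;; If 3 5 (Act (IAdd 2 2 5)) Skip ;; Act (IAdd 4 4 1)).

Lemma bound_loopP q j0 M k (Q : memory -> int -> Prop) :
  M 0%N = q%:Z -> M 1%N = 1 -> M 2%N = q%:Z -> M 3%N = 0 -> M 4%N = j0%:Z ->
  (5 < j0 <= q)%N -> (5 * q + 1)%:Z <= k ->
  (forall (B : nat) (M' : memory) (k' : int), M' 0%N = q%:Z -> M' 2%N = B%:Z -> (q <= B)%N ->
     (forall x, (5 < x)%N -> M' x = M x) ->
     (forall x, (j0 <= x < q)%N -> M x < B%:Z) ->
     k - (5 * q + 1)%:Z <= k' -> Q M' k') ->
  rwp bound_loop M k Q.
Proof.
move=> H0 H1 H2 H3 H4 Hj0 Hk HQ.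
apply: (@wp_while _ _ _ _ _ _ _ _ (fun M' k' => exists j B, [/\ (j0 <= j <= q)%N,
   M' 0%N = q%:Z /\ M' 1%N = 1, (M' 2%N = B%:Z /\ (q <= B)%N) /\ M' 3%N = 0,
   M' 4%N = j%:Z /\ (forall x, (5 < x)%N -> M' x = M x) &
   (forall x, (j0 <= x < j)%N -> M x < B%:Z) /\
   k - (5 * q + 1)%:Z + (5 * (q - j) + 1)%:Z <= k'])).
- exists j0, q; split => //; first lia.
  by split => [x|]; lia.
- by move=> M' k' [j [B [Hj _ _ _ [_ Hk']]]]; lia.
- move=> M' k' [j [B [Hj [E0 E1] [[E2 Hq] E3] [E4 Ex] [Eb Hk']]]]; rewrite E4 E0 => Hlt.
  have Ej : M' `|M' 4%N|%N = M j by rewrite E4 absz_nat Ex //; lia.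
  apply: wp_act_seq => //; apply: wp_seq.
  apply: wp_if; rewrite /= /upd /= Ej E3 => Hs; last first.
    apply: wp_skip; apply: wp_act => //.
    exists j.+1, B; rewrite /= /upd /= E0 E1 E2 E3 E4; split => //.
    + lia.
    + by split=> [|x Hx]; [lia | rewrite !ifF ?Ex //; apply/negbTE; lia].
    split; last lia.
    by move=> x Hx; have [->|Hne] := eqVneq x j; [lia | apply: Eb; lia].
  apply: wp_act => //; apply: wp_act => //.
  exists j.+1, (B + `|M j|)%N; rewrite /= /upd /= E0 E1 E2 E3 E4; split => //.
  + lia.
  + by split => //; split; lia.
  + by split=> [|x Hx]; [lia | rewrite !ifF ?Ex //; apply/negbTE; lia].
  split; last lia.
  move=> x Hx; have [->|Hne] := eqVneq x j; first lia.
  have : M x < B%:Z by apply: Eb; lia.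
  lia.
- move=> M' k' [j [B [Hj [E0 E1] [[E2 Hq] E3] [E4 Ex] [Eb Hk']]]]; rewrite E4 E0 => Hlt.
  apply: (HQ B) => //; last by lia.
  by move=> x Hx; apply: Eb; lia.
Qed.

Definition copy_loop : rcmd :=
  While 4 7 (Act (ILoad 5 6) ;; addr 0 4 ;; Act (IStore 0 5) ;;
    Act (IConst 1 1) ;; Act (IAdd 4 4 1) ;; Act (IAdd 6 6 1)).

Lemma copy_loopP (B i0 s0 e : nat) M k (Q : memory -> int -> Prop) :
  M 2%N = B%:Z -> M 4%N = i0%:Z -> M 6%N = s0%:Z -> M 7%N = e%:Z ->
  (i0 <= e)%N -> (9 < s0)%N -> (s0 + (e - i0) <= B)%N ->
  (13 * e + 1)%:Z <= k ->
  (forall (M' : memory) (k' : int), (forall x, x \in [:: 2; 8; 9]%N -> M' x = M x) ->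
     (forall j, (i0 <= j < e)%N -> M' (B + 16 * j)%N = M (s0 + (j - i0))%N) ->
     (forall x, (9 < x)%N -> (forall j, (i0 <= j < e)%N -> x != (B + 16 * j)%N) ->
        M' x = M x) ->
     k - (13 * e + 1)%:Z <= k' -> Q M' k') ->
  rwp copy_loop M k Q.
Proof.
move=> H2 H4 H6 H7 Hi0 Hs0 HB Hk HQ.
apply: (@wp_while _ _ _ _ _ _ _ _ (fun M' k' => exists i, [/\ (i0 <= i <= e)%N,
   M' 4%N = i%:Z /\ M' 7%N = e%:Z,
   M' 6%N = (s0 + (i - i0))%N%:Z /\ (forall x, x \in [:: 2; 8; 9]%N -> M' x = M x),
   (forall j, (i0 <= j < i)%N -> M' (B + 16 * j)%N = M (s0 + (j - i0))%N) /\
   (forall x, (9 < x)%N -> (forall j, (i0 <= j < i)%N -> x != (B + 16 * j)%N) ->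
        M' x = M x) &
   k - (13 * e + 1)%:Z + (13 * (e - i) + 1)%:Z <= k'])).
- exists i0; split => //; first lia.
  + by split => //; rewrite H6 subnn addn0.
  + by split => // j; lia.
  + lia.
- by move=> M' k' [i [? _ _ _ ?]]; lia.
- move=> M' k' [i [Hi [E4 E7] [E6 E289] [Ed Ex] Hk']]; rewrite E4 E7 => Hlt.
  have Es : M' `|M' 6%N|%N = M (s0 + (i - i0))%N.
    rewrite E6 absz_nat Ex //; first lia.
    by move=> j Hj; lia.
  apply: wp_act_seq => //; apply: wp_seq; rewrite /= /upd Es.
  have E2 : M' 2%N = B%:Z by rewrite E289.
  apply: (@rwp_addr B) => //=; rewrite ?E4 //.
  rewrite absz_nat addn0 => M1 E0 E1.
  have Ev : M1 5%N = M (s0 + (i - i0))%N by rewrite E1.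
  have nB x : (x < 10)%N -> (x == (B + 16 * i)%N) = false.
    by move=> Hx; apply/negbTE; lia.
  do 3!apply: wp_act_seq => //; apply: wp_act => //.
  exists i.+1; rewrite /= /upd /= E0 absz_nat !nB // Ev !E1 // E4 /= E6 /=.
  split => //.
  + lia.
  + by split; [lia |].
  + split; first lia.
    move=> x; rewrite !inE => /or3P[]/eqP->; rewrite /= nB // E1 //=;
      apply: E289; by rewrite !inE eqxx ?orbT.
  + split.
      move=> j Hj; have N r : (r < 10)%N -> ((B + 16 * j)%N == r) = false by lia.
      rewrite (N 6%N) // (N 4%N) // (N 1%N) //; have [Eji|Hne] := eqVneq j i; first by rewrite Eji eqxx.
      have -> : ((B + 16 * j)%N == (B + 16 * i)%N) = false by lia.
      by rewrite E1 ?(N 5%N) ?Ed //; lia.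
    move=> x Hx Hj; have N r : (r < 10)%N -> (x == r) = false by lia.
    rewrite (N 6%N) // (N 4%N) // (N 1%N) //; have /negPf -> : x != (B + 16 * i)%N by apply: Hj; lia.
    by rewrite E1 ?(N 5%N) ?Ex //; [move=> j Hji; apply: Hj; lia | lia].
  + lia.
- move=> M' k' [i [Hi [E4 E7] [E6 E289] [Ed Ex] Hk']]; rewrite E4 E7 => Hlt.
  have Ei : i = e by lia.
  by apply: HQ => //; rewrite -?Ei //; lia.
Qed.

Definition loader : rcmd :=
  find_end ;; Act (IConst 1 32) ;; Act (IAdd 0 0 1) ;; Act (IConst 1 1) ;; saves 2 30 ;;
  Act (IConst 3 0) ;; Act (IAdd 2 0 3) ;; Act (IConst 4 32) ;; bound_loop ;;
  Act (IConst 9 0) ;; Act (IAdd 7 0 9) ;; Act (IConst 8 30) ;; Act (ISub 8 0 8) ;;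
  Act (IConst 4 32) ;; Act (IConst 6 32) ;; copy_loop ;;
  Act (IConst 4 2) ;; Act (IAdd 6 8 9) ;; Act (IConst 7 32) ;; copy_loop.

(** [ld_inp] reaches past the encoding because the parser stops by reading a zero at index
    [size (encode H) + 1], where the head count of one more arc would be. *)
Record loaded (H : hytn) (B : nat) (s : hst) : Prop := Loaded {
  ld_size : (size (encode H) <= B)%N;
  ld_max : forall x, (1 < x)%N -> inp H x < B%:Z;
  ld_inp : forall x, (1 < x <= (size (encode H)).+1)%N -> harr s 0 x = inp H x;
  ld_zero : forall f i, (0 < f < 16)%N -> harr s f i = 0 }.

Lemma loaderP H k (Q : memory -> int -> Prop) : wf H ->
  (26 * size (encode H) + 3000)%:Z <= k ->
  (forall (B : nat) (s : hst) (M : memory) (k' : int), rep B M s -> loaded H B s ->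
     k - (26 * size (encode H) + 3000)%:Z <= k' -> Q M k') ->
  rwp loader (inp H) k Q.
Proof.
move=> wfH; set L := size (encode H) => Hk HQ.
have HL : (2 * size (arcs H) <= L)%N by rewrite /L size_encode; lia.
have Hin x : (L <= x)%N -> inp H x = 0 by move=> Hx; apply: enc_end.
rewrite /loader; apply: wp_seq; have -> : k = (`|k|%N)%:Z by lia.
apply: find_endP => //; first lia.
move=> M1 k1 E0 E1 Hk1; do 3!apply: wp_act_seq => //.
apply: wp_seq; apply: (@savesP (L + 31)%N) => //.
- lia.
- by rewrite /= /upd /= E0; lia.
move=> M2 F0 F1; do 3!apply: wp_act_seq => //.
(* Cells 2 to 31 have been saved at [L + 33] to [L + 62]; from [q] on, all memory is still zero. *)
set q := (L + 63)%N; have Eq : q = (L + 63)%N by [].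
have {}F0 : M2 0%N = q%:Z by rewrite F0 /q; congr Posz; lia.
have F1' : M2 1%N = 1 by rewrite F1 // ifF //; lia.
have Fx x : (1 < x < L + 33)%N -> M2 x = inp H x.
  move=> Hx; rewrite F1; last lia.
  rewrite ifF; last lia.
  by rewrite /= /upd !ifF ?E1 //; lia.
have Fs x : (1 < x < 32)%N -> M2 (L + 31 + x)%N = inp H x.
  move=> Hx; rewrite F1; last lia.
  rewrite ifT; last lia.
  by rewrite addKn /= /upd !ifF ?E1 //; lia.
have Fz x : (q <= x)%N -> M2 x = 0.
  move=> Hx; rewrite F1; last lia.
  rewrite ifF; last lia.
  by rewrite /= /upd !ifF ?E1 ?Hin //; lia.
apply: wp_seq; apply: (@bound_loopP q 32) => //; rewrite /= /upd /= ?F0 ?F1' //.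
- by rewrite addr0.
- lia.
- lia.
move=> B M3 k3 G0 G2 HB Gx Gb Hk3.
have {}Gx x : (5 < x)%N -> M3 x = M2 x by move=> Hx; rewrite Gx // !ifF //; lia.
have {}Gb x : (32 <= x < q)%N -> M2 x < B%:Z.
  by move=> Hx; have := Gb x Hx; rewrite !ifF //; lia.
(* Two copies follow: cells 32 to [q - 1] go under their own index, and then the saved block
   supplies the indices 2 to 31, whose original cells now serve as registers. *)
do 6!apply: wp_act_seq => //.
apply: wp_seq; apply: (@copy_loopP B 32 32 q) => //; rewrite /= /upd /= ?G0 ?addr0 //; try lia.
move=> M4 k4 H1 H2 H3 Hk4; do 3!apply: wp_act_seq => //.
have H8 : M4 8%N = (L + 33)%N%:Z by rewrite H1 //=; lia.
have H9 : M4 9%N = 0 by rewrite H1.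
have H22 : M4 2%N = B%:Z by rewrite H1.
apply: (@copy_loopP B 2 (L + 33) 32) => //; rewrite /= /upd /= ?H8 ?H9 ?addr0 //; try lia.
move=> M5 k5 I1 I2 I3 Hk5.
have {}H2 j : (32 <= j < q)%N -> M4 (B + 16 * j)%N = M2 j.
  by move=> Hj; rewrite H2 // subnKC ?Gx //; lia.
have {}H3 x : (9 < x)%N -> (forall j, (32 <= j < q)%N -> x != (B + 16 * j)%N) ->
    M4 x = M2 x.
  move=> Hx Hj; rewrite H3 // !ifF ?Gx //; lia.
have {}I2 j : (1 < j < 32)%N -> M5 (B + 16 * j)%N = inp H j.
  move=> Hj; rewrite I2 // !ifF; try lia.
  rewrite H3; [|lia|move=> j'; lia].
  by rewrite -Fs //; congr (M2 _); lia.
have {}I3 x : (9 < x)%N -> (forall j, (2 <= j < 32)%N -> x != (B + 16 * j)%N) ->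
    M5 x = M4 x.
  by move=> Hx Hj; rewrite I3 // !ifF //; lia.
have Hsave x : (1 < x)%N -> inp H x < B%:Z.
  move=> Hx; have [Hx2|Hx2] := ltnP x 32.
    by rewrite -Fs ?Hx //; apply: Gb; lia.
  have [Hx3|Hx3] := ltnP x (L + 33).
    by rewrite -Fx ?Hx //; apply: Gb; lia.
  by rewrite Hin //; lia.
apply: (HQ B (HSt M5 (fun f i => M5 (B + 16 * i + f)%N))).
- split => //=; [by rewrite I1 | by rewrite /nregs; lia].
- constructor => [||x Hx|f i Hf] //=.
  + by apply: leq_trans HB; rewrite /q leq_addr.
  + rewrite addn0; have [Hx2|Hx2] := ltnP x 32.
      by rewrite I2 //; lia.
    rewrite I3; [|lia|move=> j; lia].
    by rewrite H2 ?Fx //; lia.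
  + rewrite I3; [|lia|move=> j; lia].
    by rewrite H3 ?Fz //; [lia|lia|move=> j; lia].
- lia.
Qed.

(** * Writing an array back to the cells from 0 on *)

Fixpoint adds (d n : nat) : rcmd :=
  if n is n'.+1 then Act (IAdd d.+1 d 1) ;; adds d.+1 n' else Skip.

Lemma addsP c d n M k (Q : memory -> int -> Prop) :
  (1 < d)%N -> M 1%N = 16 -> M d = (c + 16 * d)%N%:Z ->
  (forall M', (forall x, M' x = if (d <= x <= d + n)%N then (c + 16 * x)%N%:Z else M x) ->
    Q M' (k - n%:Z)) ->
  rwp (adds d n) M k Q.
Proof.
elim: n d M k => [|n IH] d M k Hd H1 Hc HQ /=.
  apply: wp_skip; have := HQ M; rewrite subr0 addn0; apply => x.
  by case: ifP => // /anti_leq <-.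
apply: wp_act_seq => //; apply: IH => //=.
- exact: ltnW.
- by rewrite /upd ifF //; lia.
- by rewrite upd_eq Hc H1; lia.
move=> M' Hx; have -> : k - 1 - n%:Z = k - n.+1%:Z by lia.
apply: HQ => x; rewrite Hx /upd.
have [->|Hne] := eqVneq x d.
  rewrite ifF; last lia.
  rewrite ifF; last lia.
  by rewrite ifT ?Hc //; lia.
have -> : (d <= x <= d + n.+1)%N = (d < x <= d.+1 + n)%N by lia.
by case: ifP => // Hr; rewrite ifF //; lia.
Qed.

Fixpoint loads (d n : nat) : rcmd :=
  if n is n'.+1 then Act (ILoad d d) ;; loads d.+1 n' else Skip.

(** Each cell is replaced by what it points to, so no working register is needed. The addresses lie
    beyond the range being overwritten, so no load sees a modified source. *)
Lemma loadsP d n M k (Q : memory -> int -> Prop) :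
  (forall x, (d <= x < d + n)%N -> (d + n <= `|M x|)%N) ->
  (forall M', (forall x, M' x = if (d <= x < d + n)%N then M `|M x|%N else M x) ->
    Q M' (k - n%:Z)) ->
  rwp (loads d n) M k Q.
Proof.
elim: n d M k => [|n IH] d M k Hx HQ /=.
  apply: wp_skip; have := HQ M; rewrite subr0; apply => x.
  by rewrite ifF //; lia.
apply: wp_act_seq => //; apply: IH => //=.
  move=> x Hxd; rewrite upd_ne; last lia.
  by have := Hx x; lia.
move=> M' HM'; have -> : k - 1 - n%:Z = k - n.+1%:Z by lia.
apply: HQ => x; rewrite HM'.
have [->|Hne] := eqVneq x d.
  by rewrite ifF ?upd_eq ?ifT //; lia.
have -> : (d < x < d.+1 + n)%N = (d <= x < d + n.+1)%N by lia.
rewrite ![upd _ _ _ x]upd_ne //; case: ifP => // Hr.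
by rewrite upd_ne //; have := Hx x; lia.
Qed.

(** The output must also overwrite the registers. Cells from 32 on are therefore written first by a
    loop; then each of the cells 0 to 31 receives the address of its own value and loads through
    itself. *)
Definition outcopy (f : nat) : rcmd :=
  Act (IConst 4 32) ;;
  While 4 7 (addr f 4 ;; Act (ILoad 5 0) ;; Act (IStore 4 5) ;;
             Act (IConst 1 1) ;; Act (IAdd 4 4 1)) ;;
  Act (IConst 1 f%:Z) ;; Act (IAdd 0 2 1) ;; Act (IConst 1 16) ;;
  Act (IAdd 2 0 1) ;; Act (IAdd 2 2 1) ;; adds 2 29 ;; Act (IAdd 1 0 1) ;; loads 0 32.

Lemma outcopyP B f (n : nat) s M k (Q : memory -> int -> Prop) :
  rep B M s -> hreg s 7 = n%:Z -> (n <= B)%N -> (f < 16)%N ->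
  (12 * n + 200)%:Z <= k ->
  (forall (M' : memory) (k' : int), (forall x, (x < n)%N -> M' x = harr s f x) ->
    k - (12 * n + 200)%:Z <= k' -> Q M' k') ->
  rwp (outcopy f) M k Q.
Proof.
move=> [H2 HB HR HA] H7 Hn Hf Hk HQ; rewrite /nregs in HB HR.
have {HR}H7 : M 7%N = n%:Z by rewrite -H7 HR.
rewrite /outcopy; apply: wp_act_seq => //; apply: wp_seq.
apply: (@wp_while _ _ _ _ _ _ _ _ (fun M' k' => exists j : nat, [/\ (32 <= j)%N,
   M' 4%N = j%:Z /\ M' 7%N = n%:Z /\ M' 2%N = B%:Z,
   (forall x, (32 <= x < j)%N -> (x < n)%N /\ M' x = harr s f x),
   (forall x, (B <= x)%N -> M' x = M x) &
   k - 1 - (12 * n + 1)%:Z + (12 * (n - j) + 1)%:Z <= k'])).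
- exists 32%N; split => //; try lia.
  move=> x Hx; rewrite /= /upd ifF //; lia.
- by move=> M' k' [j [_ _ _ _ Hk']]; lia.
- move=> M' k' [j [Hj [E4 [E7 E2]] Ex EB Hk']]; rewrite E4 E7 => Hlt.
  apply: wp_seq; apply: (@rwp_addr B) => //; first by rewrite E4.
  rewrite E4 absz_nat => M1 E0 E1.
  have Ev : M1 (B + 16 * j + f)%N = harr s f j.
    by rewrite E1; [rewrite EB ?HA //; lia | lia].
  do 3!apply: wp_act_seq => //; apply: wp_act => //.
  have nj x : (x < 32)%N -> (x == j) = false by lia.
  exists j.+1; rewrite /= /upd /= E0 absz_nat Ev [M1 4%N]E1 // E4 absz_nat.
  rewrite !nj // !E1 //=; split => //.
  + lia.
  + by split=> //; lia.
  + move=> x Hx; split; first by lia.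
    have -> : (x == 4%N) = false by lia.
    have -> : (x == 1%N) = false by lia.
    have [->//|Hne] := eqVneq x j.
    have -> : (x == 5%N) = false by lia.
    by rewrite E1; [apply: (proj2 (Ex x _)); lia | lia].
  + move=> x Hx; rewrite !ifF; try lia.
    by rewrite E1 ?EB //; lia.
  + lia.
move=> M' k' [j [Hj [E4 [E7 E2]] Ex EB Hk']]; rewrite E4 E7 => Hlt.
do 5!apply: wp_act_seq => //.
apply: wp_seq; apply: (@addsP (B + f)%N) => //.
  by rewrite /= /upd /= E2; lia.
move=> M1 E1; apply: wp_act_seq => //.
have F x : (x < 32)%N -> upd M1 1 (M1 0%N + M1 1%N) x = (B + f + 16 * x)%N%:Z.
  move=> Hx; rewrite /upd; case: eqVneq => [->|Hx1].
    by rewrite !E1 /= /upd /= E2; lia.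
  rewrite E1; case: ifP => // Hx2.
  have -> : x = 0%N by lia.
  by rewrite /= /upd /= E2; lia.
apply: loadsP => /=; first by move=> x Hx; rewrite F //; lia.
move=> M2 E22; apply: HQ; last by lia.
move=> x Hx; rewrite E22; case: ifP => Hx2.
  rewrite (F x) // absz_nat -HA // -addnA (addnC f) addnA.
  rewrite upd_ne; last lia.
  rewrite E1 ifF; last lia.
  by rewrite /= /upd !ifF ?EB //; lia.
rewrite upd_ne; last lia.
rewrite E1 ifF; last lia.
rewrite /= /upd !ifF; try lia.
by apply: (proj2 (Ex x _)); lia.
Qed.

Definition compile (c : hcmd) (f : nat) : program :=
  asm 0 (loader ;; hcomp c ;; outcopy f).

(** [20 * K] is [8 * K] for the expansion of array operations plus [12 * n] with [n <= K] for the
    output; the leading 2 comes from assembly. The condition [n <= B] keeps the output from running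
    into the array being copied. *)
Lemma compileP H c f (K : nat) (post : hst -> Prop) : wf H -> hcmd_ok c -> (f < 16)%N ->
  (forall B s, loaded H B s ->
     hwp c s K%:Z (fun s' k' => 0 <= k' /\ exists2 n : nat,
        hreg s' 7 = n%:Z /\ (n <= B)%N & (n <= K)%N /\ post s')) ->
  exists (M : memory) s (n : nat), [/\ post s, hreg s 7 = n%:Z,
    forall x, (x < n)%N -> M x = harr s f x &
    halts_within (compile c f) (init H)
      (2 * (26 * size (encode H) + 3200 + 20 * K)) M].
Proof.
move=> wfH Hc Hf Hpost; set k := (26 * size (encode H) + 3200 + 20 * K)%N.
have Hw : rwp (loader ;; hcomp c ;; outcopy f) (inp H) k%:Z
    (fun M k' => exists s (n : nat), [/\ post s, hreg s 7 = n%:Z,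
    forall x, (x < n)%N -> M x = harr s f x & 0 <= k']).
  apply: wp_seq; apply: loaderP => //; first by rewrite /k; lia.
  move=> B s M k' HM Hs Hk'; have [t [s' [He [Ht [n [H7 Hn] [HnK Hp]]]]]] := Hpost _ _ Hs.
  have [t' [M' [E' L' R']]] := hcomp_sim He Hc HM.
  apply: wp_seq; exists t', M'; split => //.
  apply: (outcopyP R' H7) => //; first by rewrite /k in Hk'; lia.
  move=> M2 k2 HM2 Hk2; exists s', n; split => //.
  by rewrite /k in Hk'; lia.
have [t [M [He [s [n [Hp H7 HM Ht]]]]]] := Hw.
exists M, s, n; split => //.
by apply: (@asm_halts _ (inp H) t) => //; lia.
Qed.

(** * Lifting *)

Definition nupd (f : nat -> nat) (i v : nat) : nat -> nat :=
  fun x => if x == i then v else f x.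

Lemma nupd_eq f i v : nupd f i v i = v.
Proof. by rewrite /nupd eqxx. Qed.

Lemma nupd_ne f i v x : x != i -> nupd f i v x = f x.
Proof. by rewrite /nupd => /negPf ->. Qed.

Section LastOccurrence.
Variable h : nat -> nat.

(* Positions are shifted by one, 0 meaning none: these are the links of a list
   of the occurrences of [v], most recent first. *)
Fixpoint lastocc (v n : nat) : nat :=
  if n is n'.+1 then if h n' == v then n'.+1 else lastocc v n' else 0.

Definition occ (v n : nat) : nat := \sum_(e < n) (h e == v).

Lemma occS v n : occ v n.+1 = (occ v n + (h n == v))%N.
Proof. by rewrite /occ big_ord_recr. Qed.

Lemma occ_lastocc v n : occ v (lastocc v n) = occ v n.
Proof.
elim: n => //= n IH; case: ifP => // Hn.
by rewrite occS Hn addn0.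
Qed.

Lemma lastocc_le v n : (lastocc v n <= n)%N.
Proof. by elim: n => //= n IH; case: ifP => // _; apply: leqW. Qed.

Lemma lastocc_val v n c : lastocc v n = c.+1 -> h c = v.
Proof. by elim: n => //= n IH; case: eqP => // Hn [<-]. Qed.

Lemma lastocc_gt v n e : (e < n)%N -> h e = v -> (e < lastocc v n)%N.
Proof.
elim: n => //= n IH; rewrite ltnS leq_eqVlt => /predU1P[->|He] Hv.
  by rewrite Hv eqxx.
by case: ifP => _; [apply: ltnW | apply: IH].
Qed.
End LastOccurrence.

Record vstate := VState {
  sch : nat -> nat;
  ptr : nat -> nat;   (* candidate witness entry of each arc *)
  stamp : nat -> nat; (* value of the tail when the pointer was last reset *)
  lifter : nat -> nat;
  time : nat -> nat; (* of the last lift of each node *)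
  clock : nat }.

Section Lifting.
Variables (a : nat) (T F Hd : nat -> nat) (Wt : nat -> int) (W : nat).
Hypothesis F_lt : forall i, (i < a)%N -> (F i < F i.+1)%N.
Definition inarc (i e : nat) : bool := (F i <= e < F i.+1)%N.
Hypothesis Hd_T : forall i e, (i < a)%N -> inarc i e -> Hd e != T i.
Hypothesis Wt_W : forall e, (e < F a)%N -> `|Wt e| <= W%:Z.

Let E := F a.
Definition lift_bound : nat := (a * W)%N.

Lemma F_mono i j : (i <= j <= a)%N -> (F i <= F j)%N.
Proof.
elim: j => [|j IH]; first by case/andP; rewrite leqn0 => /eqP ->.
case/andP; rewrite leq_eqVlt => /predU1P[-> //|Hi] Hj.
by apply: leq_trans (IH _) (ltnW (F_lt _)) => //; rewrite -ltnS Hi ltnW.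
Qed.

Lemma inarc_lt i e : (i < a)%N -> inarc i e -> (e < E)%N.
Proof. by move=> Hi /andP[_ He]; apply: leq_trans He _; apply: F_mono; rewrite Hi leqnn. Qed.

Definition slack (s : nat -> nat) (e : nat) : int := (s (Hd e))%:Z - Wt e.

(* [inv_tight] makes the cycles of [lifter] strictly negative.  [t] and [c] matter
   only while the arcs with a head at the freshly lifted node [t] are being pushed:
   those with such an entry below [c] may still be violated and not yet pushed. *)
Record linv (g : vstate) (t c sp : nat) (stk : nat -> nat) : Prop := Inv {
  inv_ptr : forall i, (i < a)%N -> (F i <= ptr g i <= F i.+1)%N;
  inv_stamp : forall i, (i < a)%N -> (stamp g i <= sch g (T i))%N;
  inv_fail : forall i e, (i < a)%N -> (F i <= e < ptr g i)%N ->
    (stamp g i)%:Z < slack (sch g) e;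
  inv_pending : forall i, (i < a)%N ->
    [\/ exists2 x, (x < sp)%N & stk x = i,
        (ptr g i < F i.+1)%N /\ slack (sch g) (ptr g i) <= (sch g (T i))%:Z |
        exists e, [/\ (e < c)%N, inarc i e & Hd e = t]];
  inv_stk : forall x, (x < sp)%N -> (stk x < a)%N;
  inv_lifter : forall u, (0 < sch g u)%N -> (lifter g u < a)%N /\ T (lifter g u) = u;
  inv_tight : forall u e, (0 < sch g u)%N -> inarc (lifter g u) e ->
    (sch g u)%:Z + (time g u < time g (Hd e))%N%:Z <= slack (sch g) e;
  inv_clock : forall u, (time g u < clock g)%N;
  inv_time : forall u v, (0 < sch g u)%N -> (0 < sch g v)%N ->
    time g u = time g v -> u = v }.

(** An increase of a stamp by one is worth a full run of the pointer plus 2, which finances the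
    reset. The next two terms pay for pointer advances and for the lift itself. The doubled sum
    gives a lift of [v] two units per entry with head [v]: one for the push, one for the stack slot
    that the push fills. *)
Definition potential (g : vstate) : nat :=
  (\sum_(i < a) ((lift_bound.+1 - stamp g i) * (F i.+1 - F i + 2) +
                 (F i.+1 - ptr g i) + (lift_bound.+1 - sch g (T i))) +
   2 * \sum_(e < E) (lift_bound.+1 - sch g (Hd e)))%N.

Definition vinit : vstate :=
  VState (fun=> 0%N) F (fun=> 0%N) (fun=> 0%N) (fun=> 0%N) 1%N.

Lemma inv_init stk : (forall x, (x < a)%N -> stk x = x) -> linv vinit 0 0 a stk.
Proof.
move=> Hstk; split=> //=.
- by move=> i Hi; rewrite leqnn ltnW ?F_lt.
- by move=> i e _; case/andP=> H1 H2; lia.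
- by move=> i Hi; constructor 1; exists i => //; rewrite Hstk.
- by move=> x Hx; rewrite Hstk.
Qed.

Lemma inv_weaken g t c t' sp stk : linv g t 0 sp stk -> linv g t' c sp stk.
Proof.
case=> ? ? ? Hpend ? ? ? ? ?; split=> // i Hi.
by case: (Hpend i Hi) => [?|?|[e []//]]; [constructor 1 | constructor 2].
Qed.

Lemma inv_pop g sp stk : linv g 0 0 sp.+1 stk -> (ptr g (stk sp) < F (stk sp).+1)%N ->
  slack (sch g) (ptr g (stk sp)) <= (sch g (T (stk sp)))%:Z -> linv g 0 0 sp stk.
Proof.
case=> Hptr Hstamp Hfail Hpend Hstk Hlif Htight Hclk Htime H1 H2; split=> //.
  move=> i Hi; case: (Hpend i Hi) => [[x Hx <-]|?|[e []//]]; last by constructor 2.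
  have [->|Hne] := eqVneq x sp; first by constructor 2.
  by constructor 1; exists x => //; lia.
by move=> x Hx; apply: Hstk; apply: ltnW.
Qed.

Definition advance_at (g : vstate) (i : nat) : vstate :=
  VState (sch g) (nupd (ptr g) i (ptr g i).+1) (stamp g) (lifter g) (time g) (clock g).

Lemma inv_advance g sp stk : let i := stk sp in
  linv g 0 0 sp.+1 stk -> (ptr g i < F i.+1)%N ->
  (sch g (T i))%:Z < slack (sch g) (ptr g i) ->
  linv (advance_at g i) 0 0 sp.+1 stk /\ (potential (advance_at g i) < potential g)%N.
Proof.
move=> i [Hptr Hstamp Hfail Hpend Hstk Hlif Htight Hclk Htime H1 H2].
have Hi : (i < a)%N by apply: Hstk.
split; first split=> //=.
- by move=> j Hj; rewrite /nupd; case: eqP => [->|_]; have := Hptr _ Hj;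
    have := Hptr _ Hi; lia.
- move=> j e Hj; rewrite /nupd; case: eqP => [->|_]; last exact: Hfail.
  move=> He; have [->|Hne] := eqVneq e (ptr g i); last by apply: Hfail; lia.
  by apply: le_lt_trans H2; rewrite lez_nat Hstamp.
- move=> j Hj; have [->|Hne] := eqVneq j i; first by constructor 1; exists sp.
  by rewrite nupd_ne //; apply: Hpend.
rewrite /potential /= ltn_add2r (bigD1 (Ordinal Hi)) //= [X in (_ < X)%N](bigD1 (Ordinal Hi)) //=.
rewrite nupd_eq -addSn leq_add //; first by lia.
by apply: leq_sum => j Hj; rewrite nupd_ne.
Qed.

Definition reset_at (g : vstate) (i : nat) : vstate :=
  VState (sch g) (nupd (ptr g) i (F i)) (nupd (stamp g) i (sch g (T i)))
    (lifter g) (time g) (clock g).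

Lemma inv_reset g sp stk : let i := stk sp in
  linv g 0 0 sp.+1 stk -> (F i.+1 <= ptr g i)%N -> (stamp g i < sch g (T i))%N ->
  (sch g (T i) <= lift_bound)%N ->
  linv (reset_at g i) 0 0 sp.+1 stk /\ (potential (reset_at g i) < potential g)%N.
Proof.
move=> i [Hptr Hstamp Hfail Hpend Hstk Hlif Htight Hclk Htime H1 H2 H3].
have Hi : (i < a)%N by apply: Hstk.
split; first split=> //=.
- move=> j Hj; rewrite /nupd; case: eqP => [->|_]; last exact: Hptr.
  by rewrite leqnn ltnW ?F_lt.
- by move=> j Hj; rewrite /nupd; case: eqP => [->//|_]; apply: Hstamp.
- move=> j e Hj; rewrite /nupd; case: eqP => [->|_]; last exact: Hfail.
  by move=> He; lia.
- move=> j Hj; have [->|Hne] := eqVneq j i; first by constructor 1; exists sp.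
  by rewrite nupd_ne //; apply: Hpend.
rewrite /potential /= ltn_add2r (bigD1 (Ordinal Hi)) //= [X in (_ < X)%N](bigD1 (Ordinal Hi)) //=.
rewrite !nupd_eq -addSn leq_add //; last by apply: leq_sum => j Hj; rewrite !nupd_ne.
have := Hptr _ Hi; set s := sch g (T i) in H2 H3 *; set k := (F i.+1 - F i)%N => Hp.
(* One unit of the increase of the stamp is split off: its worth [k + 2] exceeds the at most [k]
   units regained by sending the pointer back. *)
have -> : (lift_bound.+1 - stamp g i = (lift_bound.+1 - s) + 1 + (s - stamp g i).-1)%N by lia.
rewrite !(mulnDl _ _ (k + 2)) mul1n.
move: ((lift_bound.+1 - s) * (k + 2))%N ((s - stamp g i).-1 * (k + 2))%N => X Y; lia.
Qed.

Definition lift_at (g : vstate) (i : nat) : vstate :=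
  VState (nupd (sch g) (T i) (sch g (T i)).+1) (ptr g) (stamp g)
    (nupd (lifter g) (T i) i) (nupd (time g) (T i) (clock g)) (clock g).+1.

(** The pointer has passed every entry since the stamp took the current value of the tail, so by
    [inv_fail] all slacks exceed that value. Integrality makes each of them at least the new value,
    which is [inv_tight] for the lifted node: its time is the newest, so no strictness is due
    yet. *)
Lemma inv_lift g sp stk : let i := stk sp in
  linv g 0 0 sp.+1 stk -> (F i.+1 <= ptr g i)%N -> (sch g (T i) <= stamp g i)%N ->
  (sch g (T i) <= lift_bound)%N ->
  linv (lift_at g i) (T i) (lastocc Hd (T i) E) sp.+1 stk /\
  (potential (lift_at g i) + 2 * occ Hd (T i) E < potential g)%N.
Proof.
move=> i [Hptr Hstamp Hfail Hpend Hstk Hlif Htight Hclk Htime H1 H2 H3].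
have Hi : (i < a)%N by apply: Hstk.
have Hge u : (sch g u <= nupd (sch g) (T i) (sch g (T i)).+1 u)%N.
  by rewrite /nupd; case: eqP => [->|].
have Hsl e : slack (sch g) e <= slack (nupd (sch g) (T i) (sch g (T i)).+1) e.
  by rewrite /slack lerD2r lez_nat.
split; first split=> //=.
- by move=> j Hj; apply: leq_trans (Hstamp _ Hj) (Hge _).
- by move=> j e Hj He; apply: lt_le_trans (Hsl e); apply: Hfail.
- move=> j Hj; case: (Hpend j Hj) => [?|[Hp1 Hp2]|[e []//]]; first by constructor 1.
  have Hin : inarc j (ptr g j) by rewrite /inarc Hp1; case/andP: (Hptr _ Hj) => ->.
  have [Et|Hne] := eqVneq (Hd (ptr g j)) (T i); last first.
    constructor 2; split => //; move: Hp2; rewrite /slack nupd_ne //.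
    by have := Hge (T j); lia.
  constructor 3; exists (ptr g j); split => //.
  by apply: lastocc_gt => //; apply: inarc_lt Hin.
- move=> u; rewrite {1}/nupd /(nupd (lifter g)); case: eqP => [->//|_]; exact: Hlif.
- move=> u e; rewrite /nupd; case: (eqVneq u (T i)) => [_|Hu] Hs Hin.
    have Hne := Hd_T Hi Hin; rewrite (negPf Hne).
    have -> : (clock g < time g (Hd e))%N = false by have := Hclk (Hd e); lia.
    rewrite /slack (negPf Hne).
    have : (stamp g i)%:Z < slack (sch g) e.
      by apply: Hfail => //; move: Hin => /andP[-> /leq_trans->].
    by rewrite /slack; lia.
  (* For another node [u], a lift of the head of [e] raises the slack by one, which covers the
     comparison of times becoming true. *)
  have := Htight u e Hs Hin; rewrite /slack.
  case: (eqVneq (Hd e) (T i)) => [->|//].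
  by rewrite Hclk; have := leq_b1 (time g u < time g (T i))%N; lia.
- by move=> u; rewrite /nupd; case: eqP => // _; apply: ltnW; rewrite ltnS Hclk.
- move=> u v; rewrite /nupd; case: (eqVneq u (T i)) => [->|Hu];
    case: (eqVneq v (T i)) => [->//|Hv] Hsu Hsv Ht.
  + by have := Hclk v; lia.
  + by have := Hclk u; lia.
  + exact: Htime.
rewrite /potential /= (bigD1 (Ordinal Hi)) //= [X in (_ < X)%N](addnC) [X in (_ < _ + X)%N](bigD1 (Ordinal Hi)) //=.
set S1 := \sum_(j < a | _) _; set S2 := \sum_(j < a | _) _.
have HS : (S1 <= S2)%N.
  by apply: leq_sum => j _; rewrite leq_add2l leq_sub2l.
set S3 := \sum_(e < E) _; set S4 := \sum_(e < E) _.
have HS2 : (S3 + occ Hd (T i) E = S4)%N.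
  rewrite /S3 /S4 /occ -big_split; apply: eq_bigr => e _ /=.
  by rewrite /nupd; case: eqP => [->|] /=; lia.
by rewrite nupd_eq; lia.
Qed.

(** The entries with head [t] are visited in decreasing position; those strictly between the next
    occurrence and [c] have another head, so nothing is skipped. Entry [c] belongs to arc [i] alone,
    as the ranges of entries are disjoint. *)
Lemma inv_push g t c i sp stk :
  linv g t c.+1 sp stk -> (i < a)%N -> inarc i c ->
  linv g t (lastocc Hd t c) sp.+1 (nupd stk sp i).
Proof.
case=> Hptr Hstamp Hfail Hpend Hstk Hlif Htight Hclk Htime Hi Hin; split=> //.
  move=> j Hj; case: (Hpend j Hj) => [[x Hx <-]|?|[e [He Hje Ht]]].
  - by constructor 1; exists x; [lia | rewrite nupd_ne //; lia].
  - by constructor 2.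
  have [Ec|Hne] := eqVneq e c; last first.
    by constructor 3; exists e; split => //; apply: lastocc_gt => //; lia.
  constructor 1; exists sp => //; rewrite nupd_eq.
  subst e; apply/eqP; case: ltngtP => // Hij.
    have : (F i.+1 <= F j)%N by apply: F_mono; rewrite Hij ltnW.
    by move: Hin Hje; rewrite /inarc; lia.
  have : (F j.+1 <= F i)%N by apply: F_mono; rewrite Hij ltnW.
  by move: Hin Hje; rewrite /inarc; lia.
by move=> x Hx; rewrite /nupd; case: eqP => // Hne; apply: Hstk; lia.
Qed.

Lemma inv_done g t stk : linv g t 0 0 stk ->
  forall i, (i < a)%N -> exists2 e, inarc i e & slack (sch g) e <= (sch g (T i))%:Z.
Proof.
move=> Hg i Hi; case: (inv_pending Hg Hi) => [[]//|[H1 H2]|[e []//]].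
exists (ptr g i) => //; rewrite /inarc H1.
by case/andP: (inv_ptr Hg Hi) => ->.
Qed.

(* At most [a] nodes have been lifted, so a value above [a * W] leaves a gap of
   width [W] in the set of values; no arc [lifter u] can cross the gap downwards. *)
Lemma lifted_gap g t c sp stk v : linv g t c sp stk -> (lift_bound < sch g v)%N ->
  exists2 x, (x < sch g v)%N & forall u, ((x < sch g u) -> (x + W < sch g u))%N.
Proof.
move=> Hg Hv.
(* The value ranges from [j * W] (excluded) to [j * W + W] (included), for [j < a], cover everything
   positive up to [a * W]. If each contained the value of some tail, these tails together with [v]
   would be [a + 1] distinct tails of [a] arcs. *)
pose hit (x i : nat) := (x < sch g (T i) <= x + W)%N.
case: (boolP (all (fun j => has (hit (j * W)%N) (iota 0 a)) (iota 0 a))) => Hall; last first.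
  have [j] := allPn Hall; rewrite mem_iota /= => Hj /hasPn Hn.
  exists (j * W)%N; first by apply: leq_ltn_trans Hv; rewrite /lift_bound leq_mul2r ltnW ?orbT.
  move=> u Hu; rewrite ltnNge; apply/negP => Hu2.
  have [Hl HT] := @inv_lifter _ _ _ _ _ Hg u (leq_ltn_trans (leq0n _) Hu).
  have := Hn (lifter g u); rewrite mem_iota /= Hl => /(_ isT).
  by rewrite /hit HT Hu Hu2.
exfalso.
pose f (j : nat) : nat := nth 0%N (iota 0 a) (find (hit (j * W)%N) (iota 0 a)).
have Hf j : (j < a)%N -> (f j < a)%N /\ hit (j * W)%N (f j).
  move=> Hj; have Hh : has (hit (j * W)%N) (iota 0 a).
    by move/allP: Hall; apply; rewrite mem_iota.
  split; last exact: nth_find.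
  have : f j \in iota 0 a by apply: mem_nth; rewrite -has_find.
  by rewrite mem_iota.
have Hlt i j : (i < j < a)%N -> (sch g (T (f i)) < sch g (T (f j)))%N.
  case/andP=> Hij Hj; have [_ /andP[_ H1]] := Hf i (ltn_trans Hij Hj).
  have [_ /andP[H2 _]] := Hf j Hj; apply: leq_ltn_trans H1 (leq_ltn_trans _ H2).
  by rewrite addnC -mulSn leq_mul2r Hij orbT.
pose us := v :: [seq T (f j) | j <- iota 0 a].
have Hus : uniq us.
  rewrite /us /=; apply/andP; split.
    apply/negP => /mapP[j]; rewrite mem_iota /= => Hj Ev.
    have [_ /andP[_ H1]] := Hf j Hj; move: Hv; rewrite Ev ltnNge => /negP; apply.
    apply: leq_trans H1 _.
    by rewrite addnC -mulSn leq_mul2r Hj orbT.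
  rewrite map_inj_in_uniq ?iota_uniq // => i j; rewrite !mem_iota /= => Hi Hj Eq.
  apply/eqP; case: ltngtP => // Hij.
    by have := Hlt i j; rewrite Hij Hj Eq ltnn => /(_ isT).
  by have := Hlt j i; rewrite Hij Hi Eq ltnn => /(_ isT).
have : (size us <= size [seq T i | i <- iota 0 a])%N.
  apply: uniq_leq_size => // u; rewrite inE => /predU1P[->|].
    have [Hl HT] := @inv_lifter _ _ _ _ _ Hg v (leq_ltn_trans (leq0n _) Hv).
    by rewrite -HT map_f // mem_iota.
  case/mapP => j; rewrite mem_iota /= => Hj ->.
  by rewrite map_f // mem_iota /= (proj1 (Hf j Hj)).
by rewrite /= !size_map size_iota ltnn.
Qed.

Lemma lifted_closed g t c sp stk v : linv g t c sp stk -> (lift_bound < sch g v)%N ->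
  exists U : nat -> bool, [/\ U v, (forall u, U u -> (0 < sch g u)%N) &
    forall u e, U u -> inarc (lifter g u) e -> U (Hd e)].
Proof.
move=> Hg Hv; have [x Hx Hgap] := lifted_gap Hg Hv.
exists (fun u => x < sch g u)%N; split => //.
  by move=> u; apply: leq_ltn_trans.
move=> u e Hu Hin; have Hu0 : (0 < sch g u)%N by apply: leq_ltn_trans Hu.
have := inv_tight Hg Hu0 Hin; have := Hgap _ Hu.
have [Hl _] := inv_lifter Hg Hu0.
by have := Wt_W (inarc_lt Hl Hin); rewrite /slack; lia.
Qed.

Hypothesis F0 : F 0 = 0%N.

Lemma locate e : (e < E)%N -> exists2 i, (i < a)%N & inarc i e.
Proof.
rewrite /E; elim: a => [|n IH]; first by rewrite F0.
have [He _|He Hn] := ltnP e (F n); last by exists n => //; apply/andP.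
by have [i Hi Hin] := IH He; exists i => //; apply: ltnW.
Qed.

Lemma potential_init :
  (potential vinit <= (lift_bound.+1 * (6 * a + 4 * E)))%N.
Proof.
have HF n : (n <= a)%N -> (\sum_(i < n) (F i.+1 - F i) = F n)%N.
  elim: n => [|n IH] Hn; first by rewrite big_ord0 F0.
  rewrite big_ord_recr /= (IH (ltnW Hn)) subnKC //.
  exact: ltnW (F_lt Hn).
rewrite /potential /= sum_nat_const card_ord subn0.
set b := lift_bound.+1.
rewrite (eq_bigr (fun i : 'I_a => (b.+1 * (F i.+1 - F i) + 3 * b)%N)); last first.
  move=> i _; move: (F i.+1 - F i)%N => k.
  by rewrite mulnDr mulSn; lia.
rewrite big_split -big_distrr /= HF // sum_nat_const card_ord -/E.
have HE : (E <= b * E)%N by rewrite leq_pmull.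
rewrite mulSn mulnDr (mulnC E b) (mulnA a) (mulnC a 3) -mulnA (mulnCA b 6) (mulnCA b 4) (mulnC a b).
by move: (b * E)%N (b * a)%N HE => x y; lia.
Qed.

End Lifting.

(** * The program: reading the input *)

Arguments upd _ _ _ _ /.
Arguments upd2 _ _ _ _ _ /.

Notation rZero := 3%N. Notation rOne := 4%N. Notation rI := 5%N. Notation rE := 6%N.
Notation rLen := 7%N. Notation rW := 8%N. Notation rJ := 9%N. Notation rEnd := 10%N.
Notation rK := 11%N. Notation rX := 12%N. Notation rY := 13%N. Notation rZ := 14%N.
Notation rB := 15%N.

Notation fIn := 0%N. Notation fTail := 1%N. Notation fOff := 2%N. Notation fHead := 3%N.
Notation fWt := 4%N. Notation fArc := 5%N. Notation fNext := 6%N. Notation fFirst := 7%N.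
Notation fSch := 8%N. Notation fPtr := 9%N. Notation fStamp := 10%N.
Notation fLift := 11%N. Notation fStk := 12%N. Notation fMark := 13%N. Notation fOut := 15%N.

Notation hConst d z := (Act (HConst d z)).
Notation hAdd d x y := (Act (HAdd d x y)).
Notation hSub d x y := (Act (HSub d x y)).
Notation hGet d f i := (Act (HGet d f i)).
Notation hPut f i x := (Act (HPut f i x)).

Definition maxreg (d x : nat) : hcmd := If d x (hAdd d x rZero) Skip.

Definition parse_entry : hcmd :=
  hGet rX fIn rJ ;; hAdd rJ rJ rOne ;; hGet rY fIn rJ ;; hAdd rJ rJ rOne ;;
  hPut fHead rE rX ;; hPut fWt rE rY ;; hPut fArc rE rI ;;
  hGet rZ fFirst rX ;; hPut fNext rE rZ ;; hAdd rE rE rOne ;; hPut fFirst rX rE ;;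
  hAdd rX rX rOne ;; maxreg rLen rX ;; maxreg rW rY ;; hSub rY rZero rY ;; maxreg rW rY.

(** The node count of the input has been overwritten, so [rLen] is recomputed as one more than the
    largest node met. [rW] collects the weights and their negations, and the last loop forms [a * W]
    by addition. Initially every arc is on the stack. *)
Definition read_input : hcmd :=
  hConst rZero 0 ;; hConst rOne 1 ;; hConst rI 0 ;; hConst rE 0 ;;
  hConst rLen 0 ;; hConst rW 0 ;; hConst rJ 2 ;;
  hConst rX 3 ;; hGet rK fIn rX ;;
  While rZero rK (
    hGet rX fIn rJ ;; hPut fTail rI rX ;; hPut fOff rI rE ;; hPut fPtr rI rE ;; hPut fStk rI rI ;;
    hAdd rX rX rOne ;; maxreg rLen rX ;; hAdd rJ rJ rOne ;; hAdd rJ rJ rOne ;;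
    hAdd rEnd rE rK ;; While rE rEnd parse_entry ;;
    hAdd rI rI rOne ;; hAdd rX rJ rOne ;; hGet rK fIn rX) ;;
  hPut fOff rI rE ;; hConst rB 0 ;; hConst rX 0 ;;
  While rX rI (hAdd rB rB rW ;; hAdd rX rX rOne).

Lemma hwp_maxreg d x R A k (Q : hst -> int -> Prop) : R rZero = 0 ->
  (forall R' (k' : int), (forall r, r != d -> R' r = R r) -> R' d = Num.max (R d) (R x) ->
    k - 2 <= k' -> Q (HSt R' A) k') ->
  hwp (maxreg d x) (HSt R A) k Q.
Proof.
move=> R3 HQ; apply: wp_if => /= Hlt.
  apply: wp_act => //=; apply: HQ; last lia.
    by move=> r Hr; rewrite upd_ne.
  by rewrite upd_eq R3 addr0; lia.
by apply: wp_skip; apply: HQ => //; lia.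
Qed.

Definition ents (H : hytn) : seq (nat * int) := flatten [seq A.2 | A <- arcs H].
Definition hdn (H : hytn) (e : nat) : nat := (nth (0%N, 0) (ents H) e).1.
Definition wtn (H : hytn) (e : nat) : int := (nth (0%N, 0) (ents H) e).2.
Definition tln (H : hytn) (i : nat) : nat := tailA (arcAt H i).
Notation offn H := (off (arcs H)).
Notation nent H := (off (arcs H) (size (arcs H))).

Lemma nth_ents H i q : (i < size (arcs H))%N -> (q < karc (arcs H) i)%N ->
  nth (0%N, 0) (ents H) (offn H i + q) = nth (0%N, 0) (arcAt H i).2 q.
Proof.
rewrite /ents /arcAt; elim: (arcs H) i => //= A l IH [|i] Hi Hq.
  by rewrite off0 nth_cat /= ifT.
by rewrite off_cons -addnA nth_cat ltnNge leq_addr /= addKn IH.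
Qed.

Section Parse.
Variables (H : hytn) (B : nat).
Hypothesis wfH : wf H.
Let a := size (arcs H).
Let F := offn H.
Let E := nent H.

Record parsed (i e : nat) (A : nat -> nat -> int) : Prop := Parsed {
  pd_in : forall x, (1 < x <= (size (encode H)).+1)%N -> A fIn x = inp H x;
  pd_tail : forall x, (x < i)%N -> A fTail x = (tln H x)%:Z;
  pd_off : forall x, (x < i)%N -> A fOff x = (F x)%:Z;
  pd_head : forall x, (x < e)%N -> A fHead x = (hdn H x)%:Z;
  pd_wt : forall x, (x < e)%N -> A fWt x = wtn H x;
  pd_arc : forall x y, (y < e)%N -> inarc F x y -> A fArc y = x%:Z;
  pd_next : forall x, (x < e)%N -> A fNext x = (lastocc (hdn H) (hdn H x) x)%:Z;
  pd_first : forall v, A fFirst v = (lastocc (hdn H) v e)%:Z;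
  pd_ptr : forall x, (x < i)%N -> A fPtr x = (F x)%:Z;
  pd_stk : forall x, (x < i)%N -> A fStk x = x%:Z;
  pd_zero : forall f x, f \in [:: fSch; fStamp; fLift; fMark; fOut] -> A f x = 0 }.

(** The length only has to exceed the nodes met in arcs: other nodes are unconstrained. The bound by
    [nnodes H] pays for the output, the bound by [B] keeps the output below the arrays. *)
Definition len_ok (i e : nat) (z : int) : Prop :=
  exists n : nat, [/\ z = n%:Z, (n <= nnodes H)%N, (n <= B)%N,
   forall x, (x < i)%N -> (tln H x < n)%N & forall x, (x < e)%N -> (hdn H x < n)%N].

Definition W_ok (e : nat) (z : int) : Prop :=
  exists w : nat, [/\ z = w%:Z, (w <= Wmax H)%N & forall x, (x < e)%N -> `|wtn H x| <= w%:Z].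

Hypothesis inp_B : forall x, (1 < x)%N -> inp H x < B%:Z.

Lemma entry_ok i e : (i < a)%N -> inarc F i e ->
  [/\ inp H (4 + 2 * i + 2 * e) = (hdn H e)%:Z, inp H (5 + 2 * i + 2 * e) = wtn H e &
      (5 + 2 * i + 2 * e <= size (encode H))%N] /\
  [/\ (hdn H e < nnodes H)%N, (hdn H e < B)%N, (`|wtn H e| <= Wmax H)%N &
      hdn H e != tln H i].
Proof.
move=> Hi /andP[He1 He2].
have Hq : (e - F i < karc (arcs H) i)%N by move: He1 He2; rewrite /F offS; lia.
have Ee : (e = F i + (e - F i))%N by lia.
have [H1 H2] := enc_entry Hi Hq.
have Hnth := nth_ents Hi Hq; rewrite -[(offn H i + _)%N]Ee in H1 H2 Hnth.
rewrite H1 H2 /hdn /wtn Hnth.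
set p := nth _ _ _; have Hp : p \in (arcAt H i).2 by apply: mem_nth.
have Hh : p.1 \in headsA (arcAt H i) by apply: map_f.
have /and5P[Ht _ Hall _ Hnot] := wf_nth wfH Hi.
have Hpn : (p.1 < nnodes H)%N by apply: (allP Hall).
split; split => //.
- rewrite size_encode -/a.
  have : (F i.+1 <= F a)%N by apply: off_mono.
  by rewrite -/F; lia.
- have : inp H (4 + 2 * i + 2 * e) < B%:Z by apply: inp_B.
  by rewrite H1.
- have HA : arcAt H i \in arcs H by apply: mem_nth.
  rewrite /Wmax; apply: leq_trans (leq_bigmax_seq _ HA isT) => /=.
  exact: (@leq_bigmax_seq _ _ xpredT (fun p : nat * int => `|p.2|%N) p).
- by apply/eqP => Eh; move: Hnot; rewrite -/(tln H i) -Eh Hh.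
Qed.

Lemma tail_ok i : (i < a)%N ->
  [/\ inp H (2 + 2 * i + 2 * F i) = (tln H i)%:Z, (tln H i < nnodes H)%N & (tln H i < B)%N].
Proof.
move=> Hi; have Ht := enc_tail Hi; have /and5P[Hn _ _ _ _] := wf_nth wfH Hi.
split => //; have : inp H (2 + 2 * i + 2 * F i) < B%:Z by apply: inp_B.
by rewrite Ht.
Qed.

Definition pregs (i j e : nat) (R : nat -> int) : Prop :=
  [/\ R rZero = 0 /\ R rOne = 1, R rI = i%:Z, R rE = e%:Z & R rJ = j%:Z].

Lemma hwp_parse_entry i e R A k (Q : hst -> int -> Prop) :
  (i < a)%N -> inarc F i e -> pregs i (4 + 2 * i + 2 * e) e R ->
  parsed i.+1 e A -> len_ok i.+1 e (R rLen) -> W_ok e (R rW) ->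
  (forall R' A' (k' : int), pregs i (4 + 2 * i + 2 * e.+1) e.+1 R' -> R' rEnd = R rEnd ->
     parsed i.+1 e.+1 A' -> len_ok i.+1 e.+1 (R' rLen) -> W_ok e.+1 (R' rW) ->
     k - 19 <= k' -> Q (HSt R' A') k') ->
  hwp parse_entry (HSt R A) k Q.
Proof.
move=> Hi Hin [[R3 R4] R5 R6 R9] HA [n [Hn1 Hn2 Hn3 Hn4 Hn5]] [w [Hw1 Hw2 Hw3]] HQ.
have [[I1 I2 Hsz] [Hh1 Hh2 Hw Hht]] := entry_ok Hi Hin.
have J1 : A fIn (4 + 2 * i + 2 * e)%N = (hdn H e)%:Z by rewrite (pd_in HA) //; lia.
have J2 : A fIn (5 + 2 * i + 2 * e)%N = wtn H e by rewrite (pd_in HA) //; lia.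
apply: wp_act_seq => /=; first by rewrite R9.
rewrite R9 absz_nat J1.
apply: wp_act_seq => //=; rewrite R9 R4.
have Ej : (4 + 2 * i + 2 * e)%N%:Z + 1 = (5 + 2 * i + 2 * e)%N%:Z by lia.
rewrite Ej; apply: wp_act_seq => //=; rewrite J2.
apply: wp_act_seq => //=; rewrite R4.
have {}Ej : (5 + 2 * i + 2 * e)%N%:Z + 1 = (4 + 2 * i + 2 * e.+1)%N%:Z by lia.
rewrite Ej; apply: wp_act_seq => /=; first by rewrite R6.
apply: wp_act_seq => /=; first by rewrite R6.
apply: wp_act_seq => /=; first by rewrite R6.
rewrite R6 R5 !absz_nat; apply: wp_act_seq => //=.
rewrite (pd_first HA); apply: wp_act_seq => /=; first by rewrite R6.
rewrite R6 absz_nat; apply: wp_act_seq => //=; rewrite R6 R4.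
have Ee : e%:Z + 1 = e.+1%:Z by lia.
rewrite Ee; apply: wp_act_seq => //=.
apply: wp_act_seq => //=; rewrite R4.
apply: wp_seq; apply: hwp_maxreg => //= R1 k1 E1 E1' Hk1.
rewrite /upd /= Hn1 in E1'.
apply: wp_seq; apply: hwp_maxreg => //=; first by rewrite E1.
move=> R2 k2 E2 E2' Hk2; rewrite (E1 rW) // (E1 rY) //= Hw1 in E2'.
apply: wp_act_seq => //=; rewrite (E2 rY) // (E2 rZero) // (E1 rY) // (E1 rZero) //= R3.
apply: hwp_maxreg => //=; first by rewrite /upd /= E2 // E1.
move=> R7 k3 E3 E3' Hk3; rewrite /upd /= E2' in E3'.
have G r : r != rW -> r != rY -> r != rLen -> R7 r = R1 r.
  by move=> D1 D2 D3; rewrite E3 // (negPf D2) E2.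
apply: HQ; last lia.
- by split; [split|..]; rewrite G // E1.
- by rewrite G // E1.
- case: HA => P1 P2 P3 P4 P5 P6 P7 P8 P9 P10 P11; split => //=.
  + by move=> x Hx; rewrite /upd; case: eqP => [->//|Hne]; apply: P4; lia.
  + by move=> x Hx; rewrite /upd; case: eqP => [->//|Hne]; apply: P5; lia.
  + move=> x y Hy Hxy; rewrite /upd; case: eqP => Hne; last by apply: P6 => //; lia.
    subst y; congr Posz; apply/eqP; case: ltngtP => // Hix.
      have : (F i.+1 <= F x)%N by rewrite /F; apply: off_mono.
      by move: Hin Hxy; rewrite /inarc; lia.
    have : (F x.+1 <= F i)%N by rewrite /F; apply: off_mono.
    by move: Hin Hxy; rewrite /inarc; lia.
  + by move=> x Hx; rewrite /upd; case: eqP => [->//|Hne]; apply: P7; lia.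
  + by move=> v; rewrite /upd eq_sym; case: eqP.
  + by move=> f x Hf; move: (P11 f x Hf); move: Hf;
      rewrite !inE => /or4P[/eqP->|/eqP->|/eqP->|/orP[]/eqP->].
- exists (maxn n (hdn H e).+1); split.
  + by rewrite E3 //= E2 // E1'; lia.
  + lia.
  + lia.
  + by move=> x Hx; have := Hn4 x Hx; lia.
  + by move=> x Hx; have [->|Hne] := eqVneq x e; [lia | have := Hn5 x; lia].
- exists (maxn w `|wtn H e|); split.
  + by rewrite E3' /upd /=; lia.
  + lia.
  + by move=> x Hx; have [->|Hne] := eqVneq x e; [lia | have := Hw3 x; lia].
Qed.

Record parse_post (s : hst) : Prop := ParsePost {
  pp_zero : hreg s rZero = 0;
  pp_one : hreg s rOne = 1;
  pp_a : hreg s rI = a%:Z;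
  pp_parsed : parsed a E (harr s);
  pp_off : forall x, (x <= a)%N -> harr s fOff x = (F x)%:Z;
  pp_len : len_ok a E (hreg s rLen);
  pp_bound : exists w : nat, [/\ hreg s rB = (a * w)%N%:Z, (w <= Wmax H)%N &
    forall x, (x < E)%N -> `|wtn H x| <= w%:Z] }.

(** The 19 credits per arc are 16 for reading it and 3 for one addition in the loop that forms the
    product. *)
Lemma hwp_parse s k (Q : hst -> int -> Prop) : loaded H B s ->
  (20 * E + 19 * a + 30)%:Z <= k ->
  (forall s' (k' : int), parse_post s' -> k - (20 * E + 19 * a + 30)%:Z <= k' -> Q s' k') ->
  hwp read_input s k Q.
Proof.
case: s => R A [Lsz Lmax Lin Lz] Hk HQ; rewrite /= in Lin Lz.
have Fmono i j : (i <= j)%N -> (F i <= F j)%N by apply: off_mono.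
have FS i : F i.+1 = (F i + karc (arcs H) i)%N by apply: offS.
have J3 i : (i <= a)%N -> (1 < 3 + 2 * i + 2 * F i <= (size (encode H)).+1)%N.
  by move=> Hi; rewrite size_encode; have := Fmono _ _ Hi; rewrite /F -/a; lia.
do 9!apply: wp_act_seq => //=.
rewrite Lin; last by have := J3 0%N; rewrite /F off0.
apply: wp_seq; apply: (@wp_while _ _ _ _ _ _ _ _ (fun s k' => exists i, [/\ (i <= a)%N,
  pregs i (2 + 2 * i + 2 * F i) (F i) (hreg s),
  hreg s rK = inp H (3 + 2 * i + 2 * F i),
  parsed i (F i) (harr s) &
  [/\ len_ok i (F i) (hreg s rLen), W_ok (F i) (hreg s rW) &
  k - (20 * E + 19 * a + 30)%:Z + (20 * (E - F i) + 16 * (a - i) + 3 * a + 10)%:Z <= k']])).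
- exists 0%N; rewrite /F off0; split => //=.
  + split => //=; try by move=> x; rewrite ltn0.
    * by move=> v; rewrite Lz.
    * by move=> f x Hf; apply: Lz; move: Hf;
        rewrite !inE => /or4P[/eqP->|/eqP->|/eqP->|/orP[]/eqP->].
  + split; [by exists 0%N; split | by exists 0%N; split | lia].
- by move=> s k' [i [_ _ _ _ [_ _ Hk']]]; lia.
- move=> [R1 A1] k1 /= [i [Hi [[R3 R4] R5 R6 R9] R11 HP [HL HW Hk1]]].
  rewrite R3 R11 => Hlt; have [Hge Hia] := enc_karc_le wfH Hi.
  have {Hge Hlt} Hia : (i < a)%N by rewrite -/a -/F in Hia; rewrite -Hia.
  have R11' : R1 rK = (karc (arcs H) i)%:Z by rewrite R11 enc_karc.
  have [T1 T2 T3] := tail_ok Hia.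
  have HFE : (F i.+1 <= E)%N by apply: Fmono.
  have HFi := FS i.
  apply: wp_act_seq => /=; first by rewrite R9.
  rewrite R9 absz_nat (pd_in HP) ?T1; last by have := J3 i Hi; lia.
  do 4!(apply: wp_act_seq => /=; first by rewrite R5).
  apply: wp_act_seq => //=; rewrite R4 R5 R6 !absz_nat.
  have Et : (tln H i)%:Z + 1 = (tln H i).+1%:Z by lia.
  rewrite Et; apply: wp_seq; apply: hwp_maxreg => //= R2 k2 E2 E2' Hk2.
  do 3!apply: wp_act_seq => //=.
  rewrite (E2 rOne) // (E2 rK) // (E2 rE) // (E2 rJ) //= R4 R6 R9 R11'.
  have Ej : (2 + 2 * i + 2 * F i)%N%:Z + 1 + 1 = (4 + 2 * i + 2 * F i)%N%:Z by lia.
  have Ee : (F i)%:Z + (karc (arcs H) i)%:Z = (F i.+1)%:Z by rewrite FS.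
  rewrite Ej Ee; apply: wp_seq.
  apply: (@wp_while _ _ _ _ _ _ _ _ (fun s k' => exists e, [/\ (F i <= e <= F i.+1)%N,
    pregs i (4 + 2 * i + 2 * e) e (hreg s), hreg s rEnd = (F i.+1)%:Z,
    parsed i.+1 e (harr s) &
    [/\ len_ok i.+1 e (hreg s rLen), W_ok e (hreg s rW) &
    k - (20 * E + 19 * a + 30)%:Z +
      (20 * (E - e) + 16 * (a - i.+1) + 3 * a + 14)%:Z <= k']])).
  + exists (F i); split => //=; first by rewrite leqnn Fmono.
    * by split=> //=; [split| |]; rewrite E2.
    * case: HP => P1 P2 P3 P4 P5 P6 P7 P8 P9 P10 P11; split => //=.
      - by move=> x Hx; case: eqP => [->//|Hne]; apply: P2; lia.
      - by move=> x Hx; case: eqP => [->//|Hne]; apply: P3; lia.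
      - by move=> x Hx; case: eqP => [->//|Hne]; apply: P9; lia.
      - by move=> x Hx; case: eqP => [->//|Hne]; apply: P10; lia.
      - by move=> f x Hf; move: (P11 f x Hf); move: Hf;
          rewrite !inE => /or4P[/eqP->|/eqP->|/eqP->|/orP[]/eqP->].
    * split; last by lia.
      - case: HL => n [N1 N2 N3 N4 N5]; exists (maxn n (tln H i).+1); split => //.
        + by rewrite E2' N1; lia.
        + lia.
        + lia.
        + by move=> x Hx; have [->|Hne] := eqVneq x i; [lia | have := N4 x; lia].
        + by move=> x Hx; have := N5 x; lia.
      - by rewrite E2.
  + by move=> s k' [e [_ _ _ _ [_ _ Hk']]]; lia.
  + move=> [R7 A7] k7 /= [e [He Hr R10 HP7 [HL7 HW7 Hk7]]].
    have [_ _ R6' _] := Hr; rewrite R6' R10 => Hlt.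
    have Hin : inarc F i e by rewrite /inarc; lia.
    apply: (hwp_parse_entry Hia Hin Hr HP7 HL7 HW7) => R8 A8 k8 Hr8 R8' HP8 HL8 HW8 Hk8.
    exists e.+1; split => //=; first by move: Hin; rewrite /inarc; lia.
      by rewrite R8'.
    split => //; lia.
  + move=> [R7 A7] k7 /= [e [He [[R3' R4'] R5' R6' R9'] R10 HP7 [HL7 HW7 Hk7]]].
    rewrite R6' R10 => Hle; have Ee' : e = F i.+1 by lia.
    subst e; do 2!apply: wp_act_seq => //=; apply: wp_act => /=; first by rewrite R9' R4'.
    exists i.+1; split => //=.
    * split => //=; [by rewrite R5' R4'; lia | by rewrite R9'; lia].
    * by rewrite R9' R4' (pd_in HP7); [congr inp; lia| have := J3 i.+1 Hia; lia].
    * split => //; lia.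
- move=> [R1 A1] k1 /= [i [Hi [[R3 R4] R5 R6 R9] R11 HP [HL HW Hk1]]].
  rewrite R3 R11 => Hle; have [Hge Hia] := enc_karc_le wfH Hi.
  have Ei : i = a by rewrite -/a -/F in Hia; lia.
  subst i; have [w [W1 W2 W3]] := HW.
  apply: wp_act_seq => /=; first by rewrite R5.
  rewrite R5 R6 absz_nat; do 2!apply: wp_act_seq => //=.
  apply: (@wp_while _ _ _ _ _ _ _ _ (fun s k' => exists x : nat, [/\ (x <= a)%N,
    hreg s rX = x%:Z /\ hreg s rB = (x * w)%N%:Z,
    (forall r, r != rX -> r != rB -> hreg s r = R1 r),
    harr s = upd2 A1 fOff a (F a) &
    k - (20 * E + 19 * a + 30)%:Z + (3 * (a - x) + 2)%:Z <= k'])).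
  + exists 0%N; split => //=.
    * by move=> r /negPf-> /negPf->.
    * by rewrite -/E in Hk1; lia.
  + by move=> s k' [x [_ _ _ _ Hk']]; lia.
  + move=> [R2 A2] k2 /= [x [Hx [X1 X2] Xr XA Hk2]].
    rewrite X1 (Xr rI) // R5 => Hlt.
    apply: wp_act_seq => //=; apply: wp_act => //=.
    exists x.+1; split => //=.
    * by rewrite X1 X2 !Xr // R4 W1; lia.
    * by move=> r H1 H2; rewrite (negPf H1) (negPf H2) Xr.
    * lia.
  + move=> [R2 A2] k2 /= [x [Hx [X1 X2] Xr XA Hk2]].
    rewrite X1 (Xr rI) // R5 => Hlt; have Ex : x = a by lia.
    subst x; apply: HQ; last lia.
    split => /=; rewrite ?(Xr rZero, Xr rOne, Xr rI, Xr rLen) //.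
    * case: HP => P1 P2 P3 P4 P5 P6 P7 P8 P9 P10 P11; rewrite XA; split => //=.
      - by move=> x Hx'; case: eqP => [->//|Hne]; apply: P3; lia.
      - by move=> f x Hf; move: (P11 f x Hf); move: Hf;
          rewrite !inE => /or4P[/eqP->|/eqP->|/eqP->|/orP[]/eqP->].
    * move=> x Hx'; rewrite XA /=; case: eqP => [->//|Hne].
      by apply: (pd_off HP); lia.
    * by exists w; split => //; rewrite X2.
Qed.

End Parse.

(** * The program: lifting *)

Notation rBad := 16%N. Notation rV := 17%N. Notation rSp := 18%N. Notation rSp1 := 19%N.
Notation rArc := 20%N. Notation rP := 21%N. Notation rT := 22%N. Notation rS := 23%N.
Notation rArc1 := 24%N. Notation rF := 25%N. Notation rH := 26%N. Notation rWt := 27%N.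
Notation rU := 28%N. Notation rC := 29%N.

Definition push_preds : hcmd :=
  hGet rC fFirst rT ;;
  While rZero rC (
    hSub rC rC rOne ;; hGet rU fArc rC ;; hPut fStk rSp rU ;; hAdd rSp rSp rOne ;;
    hGet rC fNext rC).

Definition lift_tail : hcmd :=
  hAdd rS rS rOne ;; hPut fSch rT rS ;; hPut fLift rT rArc ;;
  If rB rS (hConst rBad 1 ;; hAdd rV rT rZero ;; hConst rSp 0) push_preds.

(** One iteration makes a single move on the top arc: advance its pointer, reset it, lift its tail,
    or pop. The arc stays on the stack until its pointer shows a witness, and each move lowers the
    potential plus the stack height, so one rate of 20 credits serves for all. *)
Definition main_body : hcmd :=
  hSub rSp1 rSp rOne ;; hGet rArc fStk rSp1 ;; hGet rP fPtr rArc ;; hGet rT fTail rArc ;;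
  hGet rS fSch rT ;; hAdd rArc1 rArc rOne ;; hGet rF fOff rArc1 ;;
  If rP rF
    (hGet rH fHead rP ;; hGet rWt fWt rP ;; hGet rU fSch rH ;; hSub rU rU rWt ;;
     If rS rU (hAdd rP rP rOne ;; hPut fPtr rArc rP) (hAdd rSp rSp1 rZero))
    (hGet rU fStamp rArc ;;
     If rU rS (hGet rP fOff rArc ;; hPut fPtr rArc rP ;; hPut fStamp rArc rS) lift_tail).

Definition main_loop : hcmd :=
  hConst rBad 0 ;; hAdd rSp rI rZero ;; While rZero rSp main_body.

Section Main.
Variables (H : hytn) (B w n0 : nat).
Hypothesis wfH : wf H.
Hypothesis inp_B : forall x, (1 < x)%N -> inp H x < B%:Z.
Let a := size (arcs H).
Let F := offn H.
Let E := nent H.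
Let T := tln H.
Let Hd := hdn H.
Let Wt := wtn H.
Let bnd := lift_bound a w.

Lemma F_0 : F 0 = 0%N.
Proof. exact: off0. Qed.

Lemma F_lt i : (i < a)%N -> (F i < F i.+1)%N.
Proof. by move=> Hi; rewrite /F offS -[X in (X < _)%N]addn0 ltn_add2l karc_gt0. Qed.

Lemma Hd_T i e : (i < a)%N -> inarc F i e -> Hd e != T i.
Proof. by move=> Hi He; have [_ []] := entry_ok wfH inp_B Hi He. Qed.

Notation vinv := (linv a T F Hd Wt).
Notation pot := (potential a T F Hd w).

Record static (A : nat -> nat -> int) : Prop := Static {
  sta_tail : forall x, (x < a)%N -> A fTail x = (T x)%:Z;
  sta_off : forall x, (x <= a)%N -> A fOff x = (F x)%:Z;
  sta_head : forall x, (x < E)%N -> A fHead x = (Hd x)%:Z;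
  sta_wt : forall x, (x < E)%N -> A fWt x = Wt x;
  sta_arc : forall x y, (y < E)%N -> inarc F x y -> A fArc y = x%:Z;
  sta_next : forall x, (x < E)%N -> A fNext x = (lastocc Hd (Hd x) x)%:Z;
  sta_first : forall v, A fFirst v = (lastocc Hd v E)%:Z;
  sta_zero : forall x, A fMark x = 0 }.

Definition keep (R : nat -> int) : Prop :=
  [/\ R rZero = 0, R rOne = 1, R rI = a%:Z, R rB = bnd%:Z & R rLen = n0%:Z].

(** [time] and [clock] have no counterpart in memory: the program never consults them. *)
Record represents (g : vstate) (sp : nat) (stk : nat -> nat)
    (A : nat -> nat -> int) : Prop := Represents {
  rl_sch : forall x, A fSch x = (sch g x)%:Z;
  rl_ptr : forall x, (x < a)%N -> A fPtr x = (ptr g x)%:Z;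
  rl_stamp : forall x, A fStamp x = (stamp g x)%:Z;
  rl_lift : forall x, A fLift x = (lifter g x)%:Z;
  rl_stk : forall x, (x < sp)%N -> A fStk x = (stk x)%:Z }.

(** An overflow leaves the loop before the arcs entering the lifted node are pushed, so the
    invariant is only known with some [t] and [c] open. The fields about [lifter] and [time], from
    which the cycle is built, do not mention them. *)
Definition failed (s : hst) : Prop := exists g t c sp stk v,
  [/\ represents g sp stk (harr s), vinv g t c sp stk, hreg s rV = v%:Z & (bnd < sch g v)%N].

Definition main_inv (k0 : int) (s : hst) (k : int) : Prop :=
  [/\ keep (hreg s), static (harr s) &
   (hreg s rBad = 0 /\ exists g sp stk,
      [/\ hreg s rSp = sp%:Z, represents g sp stk (harr s), vinv g 0 0 sp stk,
          (forall u, (sch g u <= bnd)%N) & k0 + (20 * (pot g + sp) + 1)%:Z <= k]) \/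
   ([/\ hreg s rBad = 1, hreg s rSp = 0, k0 + 1 <= k & failed s])].

(** Each push costs 26 credits: 6 for the test and the instructions, 20 for the new stack entry. The
    potential released by the lift provides 40 per entry with head [t]. *)
Lemma hwp_push_preds k0 R A t g sp stk k : 0 <= k0 ->
  keep R -> static A -> R rBad = 0 -> R rSp = sp%:Z -> R rT = t%:Z ->
  represents g sp stk A -> vinv g t (lastocc Hd t E) sp stk -> (forall u, (sch g u <= bnd)%N) ->
  k0 + (20 * (pot g + sp) + 26 * occ Hd t E + 5)%:Z <= k ->
  hwp push_preds (HSt R A) k (main_inv k0).
Proof.
move=> Hk0 HK HA RB RS RT HR HI HB Hk.
apply: wp_act_seq => /=; first by rewrite RT.
rewrite RT absz_nat (sta_first HA).
apply: (@wp_while _ _ _ _ _ _ _ _ (fun s k' => exists n sp stk,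
  [/\ keep (hreg s) /\ static (harr s), hreg s rBad = 0 /\ hreg s rSp = sp%:Z,
    (n <= E)%N /\ hreg s rC = (lastocc Hd t n)%:Z,
    represents g sp stk (harr s) /\ vinv g t (lastocc Hd t n) sp stk &
    k0 + (20 * (pot g + sp) + 26 * occ Hd t n + 3)%:Z <= k'])).
- by exists E, sp, stk; split => //=; lia.
- by move=> s k' [n [sp' [stk' [_ _ _ _ Hk']]]]; lia.
- move=> [R1 A1] k1 /= [n [sp1 [stk1 [[K1 HA1] [RB1 RS1] [Hn RC1] [HR1 HI1] Hk1]]]].
  have [R3 R4 R5 R15 R7] := K1; rewrite R3 RC1.
  case Ec : (lastocc Hd t n) => [//|c] _; have Hc := lastocc_val Ec.
  have Hcn : (c < n)%N by rewrite -Ec lastocc_le.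
  have HcE : (c < E)%N by apply: leq_trans Hcn Hn.
  have [i Hi Hin] := locate F_0 HcE.
  have Ecc : (lastocc Hd t n)%:Z - 1 = c%:Z by rewrite Ec; lia.
  apply: wp_act_seq => //=; rewrite RC1 R4 Ecc.
  apply: wp_act_seq => //=; rewrite (sta_arc HA1 HcE Hin).
  apply: wp_act_seq => /=; first by rewrite RS1.
  rewrite RS1 absz_nat; apply: wp_act_seq => //=; rewrite RS1 R4.
  apply: wp_act => //=; rewrite (sta_next HA1 HcE) Hc.
  have Eocc : (occ Hd t n = (occ Hd t c).+1)%N.
    by rewrite -(occ_lastocc Hd t n) Ec occS Hc eqxx addn1.
  exists c, sp1.+1, (nupd stk1 sp1 i); split => /=.
  + split; first by split.
    by case: HA1 => P1 P2 P3 P4 P5 P6 P7 P8; split.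
  + by split=> //; lia.
  + by split=> //; apply: ltnW.
  + split; last by apply: inv_push => //; [exact: F_lt | rewrite -Ec].
    case: HR1 => P1 P2 P3 P4 P5; split => //= x Hx.
    by rewrite /nupd; case: eqP => // Hne; apply: P5; lia.
  + by lia.
- move=> [R1 A1] k1 /= [n [sp1 [stk1 [[K1 HA1] [RB1 RS1] [Hn RC1] [HR1 HI1] Hk1]]]].
  have [R3 R4 R5 R15 R7] := K1; rewrite R3 RC1 => Hle.
  have E0 : lastocc Hd t n = 0%N by lia.
  split => //; left; split => //; exists g, sp1, stk1; split => //.
    by rewrite E0 in HI1; apply: inv_weaken HI1.
  by lia.
Qed.

Lemma hwp_main_body k0 s k : 0 <= k0 -> main_inv k0 s k -> 0 < hreg s rSp ->
  hwp main_body s (k - 1) (main_inv k0).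
Proof.
case: s => R A Hk0 [] /= HK HA [|[_ -> //]] => -[RB [g [sp [stk [RS HR HI HB Hk]]]]].
rewrite RS; case: sp RS HR HI Hk => [//|sp] RS HR HI Hk _.
have [R3 R4 R5 R15 R7] := HK.
have Hi := inv_stk HI (ltnSn sp); set i := stk sp in Hi.
have [Hp1 Hp2] := andP (inv_ptr HI Hi).
have Hs1 : sp.+1%:Z - 1 = sp%:Z by lia.
apply: wp_act_seq => //=; rewrite RS R4 Hs1.
apply: wp_act_seq => //=; rewrite (rl_stk HR) // -/i.
apply: wp_act_seq => //=; rewrite (rl_ptr HR) //.
apply: wp_act_seq => //=; rewrite (sta_tail HA) //.
apply: wp_act_seq => //=; rewrite (rl_sch HR).
apply: wp_act_seq => //=; rewrite R4.
have Hi1 : i%:Z + 1 = i.+1%:Z by lia.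
rewrite Hi1; apply: wp_act_seq => //=; rewrite (sta_off HA) //.
have HFE : (F i.+1 <= E)%N by apply: off_mono.
apply: wp_if => /=; rewrite ?ltz_nat ?lez_nat => Hlt.
  have HpE : (ptr g i < E)%N by apply: leq_trans HFE.
  apply: wp_act_seq => //=; rewrite (sta_head HA) //.
  apply: wp_act_seq => //=; rewrite (sta_wt HA) //.
  apply: wp_act_seq => //=; rewrite (rl_sch HR).
  apply: wp_act_seq => //=; apply: wp_if => /= Hs.
    have [HI' Hpot] := inv_advance w HI Hlt Hs; rewrite -/i in HI' Hpot.
    apply: wp_act_seq => //=; rewrite R4; apply: wp_act => //=.
    split => //=.
      by case: HA => P1 P2 P3 P4 P5 P6 P7 P8; split.
    left; split => //; exists (advance_at g i), sp.+1, stk; split => //.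
      case: HR => P1 P2 P3 P4 P5; split => //= x Hx.
      by rewrite /nupd; case: eqP => _; [lia | apply: P2].
    by lia.
  apply: wp_act => //=; rewrite R3 addr0; split => //=.
  left; split => //; exists g, sp, stk; split => //.
  - by case: HR => P1 P2 P3 P4 P5; split => // x Hx; apply: P5; lia.
  - exact: (inv_pop HI Hlt Hs).
  - by lia.
apply: wp_act_seq => //=; rewrite (rl_stamp HR).
apply: wp_if => /=; rewrite ?ltz_nat ?lez_nat => Hs.
  have [HI' Hpot] := inv_reset F_lt HI Hlt Hs (HB _); rewrite -/i in HI' Hpot.
  apply: wp_act_seq => //=; rewrite (sta_off HA) ?(ltnW Hi) //.
  apply: wp_act_seq => //=; apply: wp_act => //=.
  split => //=.
    by case: HA => P1 P2 P3 P4 P5 P6 P7 P8; split.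
  left; split => //; exists (reset_at T F g i), sp.+1, stk; split => //.
    case: HR => P1 P2 P3 P4 P5; split => //= x.
      by rewrite /nupd; case: eqP => // _ Hx; apply: P2.
    by rewrite /nupd P3; case: eqP.
  by lia.
have [HI' Hpot] := inv_lift F_lt Hd_T HI Hlt Hs (HB _); rewrite -/i in HI' Hpot.
change (F a) with E in Hpot.
have Ht1 : (sch g (T i))%:Z + 1 = (sch g (T i)).+1%:Z by lia.
apply: wp_act_seq => //=; rewrite R4 Ht1.
apply: wp_act_seq => //=; apply: wp_act_seq => //=.
set A' := upd2 _ fLift _ _.
have HA' : static A' by case: HA => P1 P2 P3 P4 P5 P6 P7 P8; split.
have HR' : represents (lift_at T g i) sp.+1 stk A'.
  case: HR => P1 P2 P3 P4 P5; split => //= x.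
    by rewrite /A' /= /nupd P1; case: eqP.
  by rewrite /A' /= /nupd P4; case: eqP.
apply: wp_if => /=; rewrite R15 ?ltz_nat ?lez_nat => Hb.
  do 2!apply: wp_act_seq => //=; apply: wp_act => //=.
  split => //=; right; split => //; first by lia.
  exists (lift_at T g i), (T i), (lastocc Hd (T i) E), sp.+1, stk, (T i).
  by split => //=; [rewrite R3 addr0 | rewrite nupd_eq].
apply: (@hwp_push_preds k0 _ _ (T i) (lift_at T g i) sp.+1 stk) => //=.
- by move=> u; rewrite /nupd; case: eqP.
- by lia.
Qed.

Definition succeeded (s : hst) : Prop := exists g stk,
  (forall x, harr s fSch x = (sch g x)%:Z) /\ vinv g 0 0 0 stk.

Lemma hwp_main R A k (Q : hst -> int -> Prop) : parse_post H B (HSt R A) ->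
  R rB = bnd%:Z -> R rLen = n0%:Z ->
  (20 * ((bnd.+1 * (6 * a + 4 * E)) + a) + 5)%:Z <= k ->
  (forall s (k' : int), keep (hreg s) -> static (harr s) ->
     (hreg s rBad = 0 /\ succeeded s) \/ (hreg s rBad = 1 /\ failed s) ->
     k - (20 * ((bnd.+1 * (6 * a + 4 * E)) + a) + 5)%:Z <= k' -> Q s k') ->
  hwp main_loop (HSt R A) k Q.
Proof.
move=> [/= R3 R4 R5 HP HO _ _] R15 R7 Hk HQ.
set C := (20 * ((bnd.+1 * (6 * a + 4 * E)) + a) + 5)%N in Hk HQ *.
have Hpi := potential_init T Hd w F_lt F_0.
do 2!apply: wp_act_seq => //=; rewrite R3 R5 addr0.
apply: (@wp_while _ _ _ _ _ _ _ _ (main_inv (k - C%:Z))).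
- split => //=.
    by case: HP => P1 P2 P3 P4 P5 P6 P7 P8 P9 P10 P11; split => // x; apply: P11.
  left; split => //; exists (vinit F), a, (fun x => x); split => //.
  + case: HP => P1 P2 P3 P4 P5 P6 P7 P8 P9 P10 P11; split => //= x; exact: P11.
  + by apply: inv_init; [exact: F_lt |].
  + change (F a) with E in Hpi; change (lift_bound a w) with bnd in Hpi.
    by rewrite /C; lia.
- by move=> s k' [_ _ [[_ [g [sp [stk [_ _ _ _ Hk']]]]]|[_ _ Hk' _]]]; rewrite /C in Hk Hk' *; lia.
- move=> s k' Hs; have [[R3' _ _ _ _] _ _] := Hs; rewrite R3' => Hlt.
  by apply: hwp_main_body => //; lia.
- move=> s k' [HK HA Hs]; have [R3' _ _ _ _] := HK; rewrite R3' => Hle.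
  apply: HQ => //.
    case: Hs => [[RB [g [sp [stk [RS HR HI HB _]]]]]|[RB _ _ Hf]]; [left | by right].
    split => //; exists g, stk; split; first exact: rl_sch HR.
    have E0 : sp = 0%N by lia.
    by move: HI; rewrite E0.
  by case: Hs => [[_ [g [sp [stk [_ _ _ _ Hk']]]]]|[_ _ Hk' _]]; lia.
Qed.

End Main.

(** * The program: extracting a cycle *)

Notation rQ := 30%N. Notation rTop := 31%N.

(** The search queue is kept in [fOut] from index 1 on and never shrinks, so at the end it already
    is the node list in the output format. *)
Definition closure_loop : hcmd :=
  While rQ rTop (
    hGet rT fOut rQ ;; hGet rArc fLift rT ;; hGet rP fOff rArc ;;
    hAdd rArc1 rArc rOne ;; hGet rF fOff rArc1 ;;
    While rP rF (
      hGet rH fHead rP ;; hGet rU fMark rH ;;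
      If rU rOne (hPut fMark rH rOne ;; hPut fOut rTop rH ;; hAdd rTop rTop rOne) Skip ;;
      hAdd rP rP rOne) ;;
    hAdd rQ rQ rOne).

Definition arcs_loop : hcmd :=
  While rQ rTop (hGet rT fOut rQ ;; hGet rArc fLift rT ;; hAdd rX rX rOne ;;
    hPut fOut rX rArc ;; hAdd rQ rQ rOne).

Definition extract_cycle : hcmd :=
  hPut fMark rV rOne ;; hPut fOut rOne rV ;; hConst rQ 1 ;; hConst rTop 2 ;;
  closure_loop ;;
  hSub rX rTop rOne ;; hPut fOut rZero rX ;; hPut fOut rTop rX ;; hConst rQ 1 ;;
  hAdd rX rTop rZero ;; arcs_loop ;; hAdd rLen rX rOne.

Section Extract.
Variables (H : hytn) (Sg : nat -> nat) (U : nat -> bool) (v : nat).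
Let a := size (arcs H).
Let F := offn H.
Let E := nent H.
Let T := tln H.
Let Hd := hdn H.
Hypothesis U_arc : forall u, U u -> (Sg u < a)%N /\ T (Sg u) = u.
Hypothesis U_closed : forall u e, U u -> inarc F (Sg u) e -> U (Hd e).
Hypothesis U_v : U v.

Record bfs_state (l : seq nat) (s : hst) : Prop := BfsState {
  bs_reg : hreg s rZero = 0 /\ hreg s rOne = 1;
  bs_top : hreg s rTop = (size l).+1%:Z;
  bs_off : forall x, (x <= a)%N -> harr s fOff x = (F x)%:Z;
  bs_head : forall x, (x < E)%N -> harr s fHead x = (Hd x)%:Z;
  bs_lift : forall x, harr s fLift x = (Sg x)%:Z;
  bs_mark : forall x, harr s fMark x = (x \in l)%:Z;
  bs_out : forall x, (x < size l)%N -> harr s fOut x.+1 = (nth 0%N l x)%:Z;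
  bs_uniq : uniq l;
  bs_U : forall u, u \in l -> U u;
  bs_v : v \in l }.

(** Visited nodes lie in [U] and hence are tails, which bounds the queue by the number of arcs
    rather than of nodes. *)
Lemma bfs_size l s : bfs_state l s -> (size l <= a)%N.
Proof.
move=> Hl; rewrite -[a](size_iota 0) -(size_map T (iota 0 a)).
apply: uniq_leq_size; first exact: bs_uniq Hl.
move=> u /(bs_U Hl) /U_arc[H1 H2]; rewrite -H2 map_f //.
by rewrite mem_iota.
Qed.

Definition scanned (l : seq nat) (q : nat) : Prop :=
  forall j e, (j < q)%N -> inarc F (Sg (nth 0%N l j)) e -> Hd e \in l.

(** A crude cost for scanning one node, charging all [E] entries instead of those of its own arc:
    with at most [a] nodes the total still fits into |A| m. *)
Let M := (8 * E + 20)%N.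

Lemma hwp_closure_loop s l k (Q : hst -> int -> Prop) :
  bfs_state l s -> hreg s rQ = 1 -> (a * M + 1)%:Z <= k ->
  (forall s' l' (k' : int), bfs_state l' s' -> scanned l' (size l') ->
     k - (a * M + 1)%:Z <= k' -> Q s' k') ->
  hwp closure_loop s k Q.
Proof.
move=> Hl Hq Hk HQ.
have [k0 Ek0 Hk0] : exists2 k0, k0 = k - (a * M + 1)%:Z & 0 <= k0.
  by exists (k - (a * M + 1)%:Z) => //; rewrite subr_ge0.
rewrite -Ek0 in HQ.
apply: (@wp_while _ _ _ _ _ _ _ _ (fun s k' => exists l q, [/\ bfs_state l s,
   (q <= size l)%N, hreg s rQ = q.+1%:Z, scanned l q &
   k0 + ((a - q) * M + 1)%:Z <= k'])).
- by exists l, 0%N; split => //; rewrite subn0 Ek0 subrK.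
- by move=> s' k' [l' [q [_ _ _ _]]]; move: ((a - q) * M)%N => Y; lia.
- move=> [R1 A1] k1 [l1 [q [Hl1 Hq1 /= RQ Hsc Hk1]]].
  have Hsz := bfs_size Hl1; have /= RT1 := bs_top Hl1.
  have /= Bo := bs_off Hl1; have /= Bl := bs_lift Hl1; have /= Bu := bs_out Hl1.
  rewrite RQ RT1 => Hlt.
  have Hql : (q < size l1)%N by lia.
  have [/= R3 R4] := bs_reg Hl1.
  set u := nth 0%N l1 q; have Hu : u \in l1 by apply: mem_nth.
  have [Hi HT] := U_arc (bs_U Hl1 Hu); set i := Sg u in Hi HT.
  have HFE : (F i.+1 <= E)%N by apply: off_mono.
  have HFi : (F i <= F i.+1)%N by apply: off_mono.
  have Ei : i%:Z + 1 = i.+1%:Z by lia.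
  apply: wp_act_seq => /=; first by rewrite RQ.
  rewrite RQ absz_nat Bu // -/u.
  apply: wp_act_seq => //=; rewrite Bl -/i.
  apply: wp_act_seq => //=; rewrite Bo ?(ltnW Hi) //.
  apply: wp_act_seq => //=; rewrite R4 Ei.
  apply: wp_act_seq => //=; rewrite Bo //.
  have EM : ((a - q) * M = (a - q.+1) * M + M)%N.
    by rewrite -mulSnr; congr muln; lia.
  have [Z EZ] : exists Z : nat, Z = ((a - q.+1) * M)%N by eexists.
  rewrite EM -EZ /M in Hk1; apply: wp_seq.
  apply: (@wp_while _ _ _ _ _ _ _ _ (fun s k' => exists l p, [/\ bfs_state l s,
    [/\ (F i <= p <= F i.+1)%N, hreg s rP = p%:Z, hreg s rF = (F i.+1)%:Z &
        hreg s rQ = q.+1%:Z],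
    (q < size l)%N /\ nth 0%N l q = u,
    scanned l q /\ (forall e, (F i <= e < p)%N -> Hd e \in l) &
    k0 + (Z + 1)%:Z + (8 * (E - p) + 6)%:Z <= k'])).
  + exists l1, (F i); split => //.
    * by case: Hl1; split.
    * by split => //; rewrite leqnn.
    * by split => // e; lia.
    * by lia.
  + by move=> s' k' [l' [p [_ _ _ _ Hk']]]; lia.
  + move=> [R2 A2] k2 [l2 [p [Hl2 /= [Hp RP RF RQ2] [Hql2 Hnu] [Hsc2 Hsp] Hk2]]].
    rewrite RP RF => Hlt2; have {}Hlt2 : (p < F i.+1)%N by lia.
    have HpE : (p < E)%N by apply: leq_trans HFE.
    have [/= R3' R4'] := bs_reg Hl2; have /= RT2 := bs_top Hl2.
    have /= Bh := bs_head Hl2; have /= Bm := bs_mark Hl2.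
    have HUp : U (Hd p).
      by apply: (U_closed (bs_U Hl1 Hu)); rewrite -/i /inarc; lia.
    apply: wp_act_seq => /=; first by rewrite RP.
    rewrite RP absz_nat Bh //.
    apply: wp_act_seq => //=; rewrite Bm.
    apply: wp_seq; apply: wp_if => /=; rewrite R4' => Hmk.
      have Hnot : Hd p \notin l2 by move: Hmk; case: (_ \in _).
      do 2!apply: wp_act_seq => //=; first by rewrite RT2.
      apply: wp_act => //=; rewrite RT2 R4' /=.
      apply: wp_act => //=; rewrite RP R4'.
      exists (rcons l2 (Hd p)), p.+1; split => /=.
      - case: Hl2 => /= P0 P1 P2 P3 P4 P5 P6 P7 P8 P9; split => //=.
        + by rewrite size_rcons; lia.
        + move=> x; rewrite mem_rcons inE P5; case: eqP => [->|] //.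
        + move=> x; rewrite size_rcons nth_rcons ltnS leq_eqVlt eqSS => /predU1P[->|Hx].
            by rewrite ltnn eqxx.
          by rewrite Hx P6 // ltn_eqF.
        + by rewrite rcons_uniq Hnot.
        + by move=> y; rewrite mem_rcons inE => /predU1P[->|/P8].
        + by rewrite mem_rcons inE P9 orbT.
      - by split => //; lia.
      - by rewrite size_rcons nth_rcons Hql2; split => //; apply: ltnW.
      - split=> [j e Hj|e He].
          rewrite nth_rcons (ltn_trans Hj Hql2) => He.
          by rewrite mem_rcons inE (Hsc2 j) ?orbT.
        rewrite mem_rcons inE; have [->|Hne] := eqVneq e p; first by rewrite eqxx.
        by rewrite Hsp ?orbT //; lia.
      - by lia.
    have Hin : Hd p \in l2 by move: Hmk; case: (_ \in _).
    apply: wp_skip; apply: wp_act => //=; rewrite RP R4'.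
    exists l2, p.+1; split => //=.
    - by case: Hl2; split.
    - by split => //; lia.
    - split=> // e He; have [->//|Hne] := eqVneq e p; apply: Hsp; lia.
    - by lia.
  + move=> [R2 A2] k2 [l2 [p [Hl2 /= [Hp RP RF RQ2] [Hql2 Hnu] [Hsc2 Hsp] Hk2]]].
    rewrite RP RF => Hle; have Ep : p = F i.+1 by lia.
    have [/= R3' R4'] := bs_reg Hl2.
    apply: wp_act => //=; rewrite RQ2 R4'.
    exists l2, q.+1; split => //=.
    * by case: Hl2; split.
    * by lia.
    * move=> j e; rewrite ltnS leq_eqVlt => /predU1P[->|Hj]; last exact: Hsc2.
      by rewrite Hnu => He; apply: Hsp; rewrite Ep.
    * by rewrite -EZ; lia.
- move=> s' k' [l' [q [Hl' Hq' RQ Hsc Hk']]]; rewrite RQ (bs_top Hl') => Hle.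
  have Eq : q = size l' by lia.
  by apply: (HQ _ l') => //; [rewrite -Eq | lia].
Qed.

(** This is the layout decoded by [out_S] and [out_C]. Both counts are [size l] because a cycle has
    exactly one arc per node. *)
Record cycle_out (l : seq nat) (s : hst) : Prop := CycleOut {
  co_len : hreg s rLen = (2 * size l + 2)%N%:Z;
  co_size : harr s fOut 0 = (size l)%:Z;
  co_node : forall x, (x < size l)%N -> harr s fOut x.+1 = (nth 0%N l x)%:Z;
  co_size2 : harr s fOut (size l).+1 = (size l)%:Z;
  co_arc : forall x, (x < size l)%N -> harr s fOut (size l + 2 + x) = (Sg (nth 0%N l x))%:Z }.

Lemma hwp_extract_cycle R A k (Q : hst -> int -> Prop) :
  R rZero = 0 -> R rOne = 1 -> R rV = v%:Z ->
  (forall x, (x <= a)%N -> A fOff x = (F x)%:Z) ->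
  (forall x, (x < E)%N -> A fHead x = (Hd x)%:Z) ->
  (forall x, A fLift x = (Sg x)%:Z) -> (forall x, A fMark x = 0) ->
  (a * M + 6 * a + 12)%:Z <= k ->
  (forall s l (k' : int), cycle_out l s -> uniq l -> v \in l ->
     (forall u, u \in l -> U u) ->
     (forall u e, u \in l -> inarc F (Sg u) e -> Hd e \in l) -> (size l <= a)%N ->
     k - (a * M + 6 * a + 12)%:Z <= k' -> Q s k') ->
  hwp extract_cycle (HSt R A) k Q.
Proof.
move=> R3 R4 RV A1 A2 A3 A4 Hk HQ.
apply: wp_act_seq => /=; first by rewrite RV.
rewrite RV R4 absz_nat; apply: wp_act_seq => /=; first by rewrite R4.
rewrite R4 RV absz_nat; do 2!apply: wp_act_seq => //=.
apply: wp_seq; apply: (@hwp_closure_loop _ [:: v]) => //=.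
- split => //=.
  + by move=> x; rewrite inE; case: eqP => // _; rewrite A4.
  + by case.
  + by move=> u; rewrite inE => /eqP->.
  + by rewrite inE.
- by lia.
move=> [R1 B1] l k1 Hl Hsc Hk1.
have Hsz := bfs_size Hl.
have [/= R3' R4'] := bs_reg Hl; have /= RT := bs_top Hl.
have Et : (size l).+1%:Z - 1 = (size l)%:Z by lia.
apply: wp_act_seq => //=; rewrite RT R4' Et.
apply: wp_act_seq => /=; first by rewrite R3'.
rewrite R3' absz0; apply: wp_act_seq => /=; first by rewrite RT.
rewrite RT absz_nat; do 2!apply: wp_act_seq => //=.
rewrite RT R3' addr0; apply: wp_seq.
apply: (@wp_while _ _ _ _ _ _ _ _ (fun s k' => exists q, [/\ (q <= size l)%N,
   hreg s rQ = q.+1%:Z /\ hreg s rX = ((size l).+1 + q)%N%:Z,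
   [/\ hreg s rOne = 1, hreg s rTop = (size l).+1%:Z &
       forall x, harr s fLift x = (Sg x)%:Z],
   [/\ harr s fOut 0 = (size l)%:Z, harr s fOut (size l).+1 = (size l)%:Z,
    forall x, (x < size l)%N -> harr s fOut x.+1 = (nth 0%N l x)%:Z &
    forall x, (x < q)%N -> harr s fOut (size l + 2 + x) = (Sg (nth 0%N l x))%:Z] &
   k1 - (6 * a + 7)%:Z + (6 * (a - q) + 2)%:Z <= k'])).
- exists 0%N; split => //=.
  + by split => //; rewrite addn0.
  + by split => //; exact: (bs_lift Hl).
  + split => //; first by rewrite eqxx.
    move=> x Hx; have -> : (x.+1 == (size l).+1) = false by lia.
    exact: (bs_out Hl).
  + by lia.
- by move=> s k' [q [_ _ _ _ Hk']]; lia.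
- move=> [R2 B2] k2 /= [q [Hq [RQ RX] [R42 RT2 HL2] [O1 O2 O3 O4] Hk2]].
  rewrite RQ RT2 => Hlt; have Hql : (q < size l)%N by lia.
  apply: wp_act_seq => /=; first by rewrite RQ.
  rewrite RQ absz_nat O3 //; apply: wp_act_seq => //=; rewrite HL2.
  have Ex : ((size l).+1 + q)%N%:Z + 1 = (size l + 2 + q)%N%:Z by lia.
  apply: wp_act_seq => //=; rewrite RX R42 Ex.
  apply: wp_act_seq => //=; apply: wp_act => //=; rewrite RQ R42.
  exists q.+1; split => //=.
  + by split; lia.
  + split.
    * by have -> : (0%N == (size l + 2 + q)%N) = false by lia.
    * by have -> : ((size l).+1 == (size l + 2 + q)%N) = false by lia.
    * move=> x Hx; have -> : (x.+1 == (size l + 2 + q)%N) = false by lia.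
      exact: O3.
    * move=> x Hx; rewrite eqn_add2l; case: eqP => [->//|Hne]; apply: O4; lia.
  + by lia.
- move=> [R2 B2] k2 /= [q [Hq [RQ RX] [R42 RT2 HL2] [O1 O2 O3 O4] Hk2]].
  rewrite RQ RT2 => Hle; have Eq : q = size l by lia.
  rewrite {q RQ Hq Hle}Eq in RX O4 Hk2; apply: wp_act => //=; rewrite RX R42.
  apply: (HQ _ l) => //.
  + by split => //=; lia.
  + exact: bs_uniq Hl.
  + exact: bs_v Hl.
  + exact: bs_U Hl.
  + move=> u e Hu; rewrite -(nth_index 0%N Hu); apply: Hsc.
    by rewrite index_mem.
  + by move: (a * M)%N Hk1 => X Hk1; lia.
Qed.

End Extract.

(** * Negative cycles and inconsistency *)

Lemma min_heads_le A f h : h \in headsA A -> min_heads A f <= f h.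
Proof.
rewrite /min_heads; case: (headsA A) => // x s.
elim: s => [|y s IH] /=; first by rewrite inE => /eqP ->.
rewrite !inE ge_min => /or3P[Hh|/eqP->|Hh]; last 1 first.
- by apply/orP; right; apply: IH; rewrite inE Hh orbT.
- by apply/orP; right; apply: IH; rewrite inE Hh.
- by rewrite lexx.
Qed.

Lemma min_heads_ex A f : headsA A != [::] -> exists2 h, h \in headsA A & min_heads A f = f h.
Proof.
rewrite /min_heads; case: (headsA A) => // x s _.
elim: s => [|y s [h Hh Eh]] /=; first by exists x => //; rewrite inE.
rewrite Eh; case: (leP (f y) (f h)) => _; first by exists y => //; rewrite !inE eqxx orbT.
by exists h => //; move: Hh; rewrite !inE => /orP[->//|->]; rewrite !orbT.
Qed.

Lemma weightA_mem A p : uniq (headsA A) -> p \in A.2 -> weightA A p.1 = p.2.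
Proof.
rewrite /headsA /weightA; elim: A.2 => // q s IH /= /andP[Hq Hs].
rewrite inE => /predU1P[->|Hp]; first by rewrite eqxx.
rewrite ifF; first exact: IH.
by apply/eqP => Eq; move: Hq; rewrite Eq map_f.
Qed.

Section NegativeCycle.
Variable H : hytn.
Hypothesis wfH : wf H.
Let a := size (arcs H).

Lemma inarc_head i e : (i < a)%N -> inarc (offn H) i e ->
  hdn H e \in headsA (arcAt H i) /\ weightA (arcAt H i) (hdn H e) = wtn H e.
Proof.
move=> Hi /andP[H1 H2].
have Hq : (e - offn H i < karc (arcs H) i)%N by move: H2; rewrite offS; lia.
have := nth_ents Hi Hq; rewrite subnKC // => Ee.
have Hp : nth (0%N, 0) (ents H) e \in (arcAt H i).2 by rewrite Ee mem_nth.
have /and5P[_ _ _ Hu _] := wf_nth wfH Hi.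
by split; [apply: map_f | apply: weightA_mem].
Qed.

Lemma head_inarc i h : (i < a)%N -> h \in headsA (arcAt H i) ->
  exists2 e, inarc (offn H) i e & hdn H e = h /\ weightA (arcAt H i) h = wtn H e.
Proof.
move=> Hi /mapP[p Hp ->].
have Hq : (index p (arcAt H i).2 < karc (arcs H) i)%N by rewrite index_mem.
have Hin : inarc (offn H) i (offn H i + index p (arcAt H i).2).
  by rewrite /inarc leq_addr offS ltn_add2l.
exists (offn H i + index p (arcAt H i).2)%N => //.
have Eh : hdn H (offn H i + index p (arcAt H i).2) = p.1.
  by rewrite /hdn nth_ents // nth_index.
by split => //; rewrite -Eh; have [] := inarc_head Hi Hin.
Qed.

Lemma aof_map (Sg : nat -> nat) l v : uniq l ->
  (forall u, u \in l -> tln H (Sg u) = u) -> v \in l -> aof H (map Sg l) v = Sg v.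
Proof.
move=> Hu HT Hv; rewrite /aof filter_map.
have -> : [seq x <- l | preim Sg (fun i => tailA (arcAt H i) == v) x] = [:: v].
  rewrite -(filter_pred1_uniq Hu Hv); apply: eq_in_filter => x Hx /=.
  by rewrite -/(tln H (Sg x)) HT.
by [].
Qed.

(* Around a cycle of [Sg] the values of [s] telescope to zero, and the times of
   the last lifts cannot be nonincreasing all the way, since they are distinct. *)
Lemma strategy_negative_cycle (s tm Sg : nat -> nat) l :
  uniq l -> l != [::] ->
  (forall u, u \in l -> (Sg u < a)%N /\ tln H (Sg u) = u) ->
  (forall u e, u \in l -> inarc (offn H) (Sg u) e -> hdn H e \in l) ->
  (forall u e, u \in l -> inarc (offn H) (Sg u) e ->
     (s u)%:Z + (tm u < tm (hdn H e))%N%:Z <= slack (hdn H) (wtn H) s e) ->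
  {in l &, injective tm} ->
  is_negative_cycle H l (map Sg l).
Proof.
move=> Hu Hne HSg Hcl Hs Htm.
have HT u : u \in l -> tln H (Sg u) = u by move=> /HSg[].
have Hinj : {in l &, injective Sg} by move=> x y /HT Hx /HT Hy E; rewrite -Hx -Hy E.
split.
  split => //.
  - rewrite Hu map_inj_in_uniq // Hu /=.
    by apply/allP => i /mapP[u /HSg[Hi _] ->].
  - move=> v; split.
      move=> Hv; exists (Sg v); split; first exact: map_f.
      by rewrite -/(tln H (Sg v)) HT // eqxx.
    case=> i [/mapP[u Hul ->]] /orP[/eqP->|].
      by rewrite -/(tln H (Sg u)) HT.
    have [Hi _] := HSg u Hul.
    by case/(head_inarc Hi) => e He [<- _]; apply: Hcl He.
  - move=> v Hv; rewrite count_map.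
    rewrite (@eq_in_count _ _ (pred1 v)); first by rewrite count_uniq_mem // Hv.
    by move=> u Hul /=; rewrite -/(tln H (Sg u)) HT.
move=> vs [Hsz Hall Hstep Hloop _].
have [p Ep] : exists p, size vs = p.+1 by exists (size vs).-1; rewrite (ltn_predK Hsz).
rewrite Ep /= in Hsz Hstep Hloop; have Hp : (0 < p)%N by [].
pose x := nth 0%N vs.
have Hx t : (t <= p)%N -> x t \in l.
  by move=> Ht; apply: (allP Hall); apply: mem_nth; rewrite Ep.
have Hw t : (t < p)%N -> weightA (arcAt H (aof H (map Sg l) (x t))) (x t.+1)
    <= (s (x t.+1))%:Z - (s (x t))%:Z - (tm (x t) < tm (x t.+1))%N%:Z
    /\ x t != x t.+1.
  move=> Ht; have Hxt := Hx t (ltnW Ht); rewrite aof_map //.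
  have := Hstep t; rewrite -/(x t) -/(x t.+1) aof_map // => Hh.
  have {}Hh : x t.+1 \in headsA (arcAt H (Sg (x t))) by apply: Hh.
  have [Hi _] := HSg _ Hxt; split; last first.
    apply/eqP => Ext; have /and5P[_ _ _ _] := wf_nth wfH Hi.
    by rewrite -/(tln H (Sg (x t))) HT // {1}Ext Hh.
  have [e He [Eh ->]] := head_inarc Hi Hh.
  by have := Hs _ _ Hxt He; rewrite /slack Eh; lia.
have Hlt : (0 < \sum_(0 <= t < p) (tm (x t) < tm (x t.+1)))%N.
  rewrite lt0n; apply/negP => /eqP/eqP; rewrite sum_nat_seq_eq0 => /allP Hz.
  have Hmono t : (t < p)%N -> (tm (x t.+1) <= tm (x t))%N.
    move=> Ht; have := Hz t; rewrite mem_index_iota Ht => /(_ isT).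
    by rewrite eqb0 -leqNgt.
  have Hle t : (0 < t <= p)%N -> (tm (x t) <= tm (x 1))%N.
    elim: t => // -[|t] IH // Ht; apply: leq_trans (Hmono _ _) (IH _); lia.
  (* The walk returns to its start, so times that never increase must all agree; injectivity then
     identifies [x 0] with [x 1], although no tail is among its own heads. *)
  have E01 : tm (x 0%N) = tm (x 1%N).
    apply/eqP; rewrite eqn_leq Hmono // andbT.
    by rewrite {1}/x -Hloop; apply: Hle; rewrite Hp leqnn.
  have [_ /eqP] := Hw 0%N Hp; apply; apply: Htm => //; apply: Hx => //.
have Hsum : \sum_(0 <= t < p) ((s (x t.+1))%:Z - (s (x t))%:Z) = 0.
  rewrite telescope_sumr // /x Hloop.
  by rewrite subrr.
rewrite /cyc_weight Ep /=.
apply: (@le_lt_trans _ _ (\sum_(0 <= t < p) ((s (x t.+1))%:Z - (s (x t))%:Z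
   - (tm (x t) < tm (x t.+1))%N%:Z))).
  rewrite !big_nat; apply: ler_sum => t /andP[_ Ht].
  by have [] := Hw t Ht.
rewrite sumrB Hsum sub0r oppr_lt0.
by rewrite -(big_morph Posz PoszD (erefl 0%:Z)).
Qed.

Lemma negative_cycle_inconsistent S C : is_negative_cycle H S C -> ~ consistent H.
Proof.
move=> [[/and3P[_ _ HC] Hne HS Hcnt] Hneg] [s Hs].
have HaofC v : v \in S -> aof H C v \in C /\ tailA (arcAt H (aof H C v)) = v.
  move=> Hv; have := Hcnt v Hv; rewrite -size_filter /aof => Hsz.
  have : head 0%N [seq i <- C | tailA (arcAt H i) == v] \in
      [seq i <- C | tailA (arcAt H i) == v].
    by case: [seq i <- C | _] Hsz => //= i r _; rewrite inE eqxx.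
  by rewrite mem_filter => /andP[/eqP].
have Haof v : v \in S -> (aof H C v < a)%N by move=> /HaofC[/(allP HC)].
(* [f] follows the first head that witnesses the constraint of a(v); it maps [S] into itself, so its
   orbits must loop. *)
pose ok v h := s h - (weightA (arcAt H (aof H C v)) h)%:~R <= s v.
pose f v := nth 0%N (headsA (arcAt H (aof H C v))) (find (ok v) (headsA (arcAt H (aof H C v)))).
have Hf v : v \in S -> [/\ f v \in S, f v \in headsA (arcAt H (aof H C v)) & ok v (f v)].
  move=> Hv; have [HvC Ht] := HaofC v Hv; have Hi := Haof v Hv.
  have /and5P[_ Hn0 _ _ _] := wf_nth wfH Hi.
  have HA : arcAt H (aof H C v) \in arcs H by apply: mem_nth.
  have [h Hh Eh] := min_heads_ex (fun v0 => s v0 - (weightA (arcAt H (aof H C v)) v0)%:~R) Hn0.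
  have Hhas : has (ok v) (headsA (arcAt H (aof H C v))).
    by apply/hasP; exists h => //; rewrite /ok -Eh -[X in _ <= s X]Ht; apply: Hs.
  have Hfh : f v \in headsA (arcAt H (aof H C v)) by apply: mem_nth; rewrite -has_find.
  split => //; last exact: (nth_find 0%N Hhas).
  by apply/HS; exists (aof H C v); split => //; rewrite Hfh orbT.
have [v0 Hv0] : exists v0, v0 \in S.
  by case: (S) Hne => // v r _; exists v; rewrite inE eqxx.
have HfS n : iter n f v0 \in S by elim: n => //= n /Hf[].
have Hex : exists n, looping f v0 n.
  exists (size S); apply/negPn/negP; rewrite -looping_uniq => Hu.
  have : (size (traject f v0 (size S).+1) <= size S)%N.
    by apply: uniq_leq_size => // x /trajectP[n _ ->].
  by rewrite size_traject ltnn.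
(* Taking the least looping length makes the first [n] iterates distinct, so the loop from [x] on
   has no repetition except its end, as [cyclic_seq] demands. *)
have [n Hn Hmin] := ex_minnP Hex.
have Hun : uniq (traject f v0 n).
  case: n Hn Hmin => // n _ Hmin; rewrite looping_uniq; apply/negP => /Hmin.
  by rewrite ltnn.
have [i Hi Ei] := trajectP Hn.
pose x := iter i f v0; pose p := (n - i)%N.
have Hp : (0 < p)%N by rewrite subn_gt0.
have Exp : iter p f x = x.
  by rewrite /x /p -iterD (subnK (ltnW Hi)); symmetry.
have HxS t : iter t f x \in S by rewrite /x -iterD.
have Hup : uniq (traject f x p).
  move: Hun; rewrite -(subnKC (ltnW Hi)) trajectD cat_uniq => /and3P[_ _].
  by [].
have Hnth t : (t <= p)%N -> nth 0%N (traject f x p.+1) t = iter t f x.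
  by move=> Ht; rewrite (set_nth_default x) ?nth_traject ?size_traject.
have Hcyc : cyclic_seq H S C (traject f x p.+1).
  split.
  - by rewrite size_traject ltnS.
  - by apply/allP => y /trajectP[t _ ->].
  - move=> t; rewrite size_traject ltnS => Ht; rewrite !Hnth //; last exact: ltnW.
    by have [] := Hf _ (HxS t).
  - by rewrite size_traject !Hnth //= Exp.
  - by rewrite size_traject [_.-1]/= take_traject.
have := Hneg _ Hcyc; rewrite /cyc_weight size_traject [_.-1]/=; apply/negP; rewrite -leNgt.
rewrite -(ler_int R) rmorph_sum.
apply: (@le_trans _ _ (\sum_(0 <= t < p) (s (iter t.+1 f x) - s (iter t f x)))).
  by rewrite telescope_sumr // Exp subrr.
rewrite !big_nat; apply: ler_sum => t /andP[_ Ht]; rewrite !Hnth //; last exact: ltnW.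
have [_ _] := Hf _ (HxS t); rewrite /ok /= => Hok.
by rewrite lerBlDr addrC -lerBlDr.
Qed.

End NegativeCycle.

(** * Correctness and running time *)

Lemma halts_within_le P c k k' M : (k <= k')%N -> halts_within P c k M -> halts_within P c k' M.
Proof. by move=> Hk [t Ht HM]; exists t => //; apply: leq_trans Hk. Qed.

(** Negativity is stated for every nonempty closed list inside [U], since it is used twice: for all
    of [U], to refute consistency, and for the nodes reached by the search, to certify the output.
    The schedule [t] is compared below [rLen] only, because no further cells are copied out. *)
Record solved (H : hytn) (B : nat) (s : hst) : Prop := Solved {
  sv_reg : hreg s rZero = 0 /\ hreg s rOne = 1;
  sv_len : exists n : nat, [/\ hreg s rLen = n%:Z, (n <= nnodes H)%N & (n <= B)%N];
  sv_case :
    (hreg s rBad = 0 /\ forall t : nat -> int,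
       (forall x, x%:Z < hreg s rLen -> t x = harr s fSch x) ->
       feasible H (fun x => (t x)%:~R)) \/
    (hreg s rBad = 1 /\ exists (Sg : nat -> nat) (U : nat -> bool) (v : nat),
      [/\ hreg s rV = v%:Z /\ U v,
          forall u, U u -> (Sg u < size (arcs H))%N /\ tln H (Sg u) = u,
          forall u e, U u -> inarc (offn H) (Sg u) e -> U (hdn H e),
          forall l, uniq l -> l != [::] -> (forall u, u \in l -> U u) ->
            (forall u e, u \in l -> inarc (offn H) (Sg u) e -> hdn H e \in l) ->
            is_negative_cycle H l (map Sg l) &
          [/\ forall x, (x <= size (arcs H))%N -> harr s fOff x = (offn H x)%:Z,
            forall x, (x < nent H)%N -> harr s fHead x = (hdn H x)%:Z,
            forall x, harr s fLift x = (Sg x)%:Z &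
            forall x, harr s fMark x = 0]]) }.

Lemma feasible_schedule H (sc : nat -> nat) (t : nat -> int) (n : nat) : wf H ->
  (forall i, (i < size (arcs H))%N -> exists2 e, inarc (offn H) i e &
     slack (hdn H) (wtn H) sc e <= (sc (tln H i))%:Z) ->
  (forall i, (i < size (arcs H))%N -> (tln H i < n)%N) ->
  (forall e, (e < nent H)%N -> (hdn H e < n)%N) ->
  (forall x, (x < n)%N -> t x = (sc x)%:Z) ->
  feasible H (fun x => (t x)%:~R).
Proof.
move=> wfH Hs HT HH Ht A HA.
have Hi : (index A (arcs H) < size (arcs H))%N by rewrite index_mem.
have EA : arcAt H (index A (arcs H)) = A by rewrite /arcAt nth_index.
have [e He Hle] := Hs _ Hi.
have [Hh Hw] := inarc_head wfH Hi He; rewrite EA in Hh Hw.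
apply: le_trans (min_heads_le _ Hh) _.
rewrite Hw -intrB ler_int Ht; last first.
  apply: HH; case/andP: He => _ /leq_trans; apply; exact: off_mono.
have ET : tailA A = tln H (index A (arcs H)) by rewrite /tln EA.
by rewrite ET Ht; [apply: Hle | apply: HT].
Qed.

Definition solve_cost (H : hytn) : nat :=
  (20 * nent H + 19 * size (arcs H) + 30 +
   (20 * (((size (arcs H) * Wmax H).+1 * (6 * size (arcs H) + 4 * nent H))
          + size (arcs H)) + 5))%N.

Lemma hwp_solve H B s k (rest : hcmd) (Q : hst -> int -> Prop) : wf H -> loaded H B s ->
  (solve_cost H)%:Z <= k ->
  (forall s' (k' : int), solved H B s' -> k - (solve_cost H)%:Z <= k' -> hwp rest s' k' Q) ->
  hwp (read_input ;; main_loop ;; rest) s k Q.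
Proof.
move=> wfH Hld Hk HQ; have HB := ld_max Hld.
rewrite /solve_cost in Hk HQ.
set P := (20 * nent H + 19 * size (arcs H) + 30)%N in Hk HQ.
apply: wp_seq; apply: (hwp_parse wfH HB Hld); rewrite -/P; first by lia.
move=> [R A] k1 Hpp Hk1.
have [n [Hn1 Hn2 Hn3 Hn4 Hn5]] := pp_len Hpp.
have [w [Hw1 Hw2 Hw3]] := pp_bound Hpp.
have Hcost : ((lift_bound (size (arcs H)) w).+1 * (6 * size (arcs H) + 4 * nent H)
    <= (size (arcs H) * Wmax H).+1 * (6 * size (arcs H) + 4 * nent H))%N.
  by rewrite leq_mul2r ltnS leq_mul2l Hw2 !orbT.
set X := (_.+1 * _)%N in Hcost; set Y := (_.+1 * _)%N in Hcost Hk HQ.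
apply: wp_seq; apply: (@hwp_main H B w n wfH HB R A) => //; rewrite -/X; first by lia.
move=> s2 k2 [K3 K4 K5 K15 K7] Hst Hcase Hk2; apply: HQ; last by lia.
split; first by split.
  by exists n.
case: Hcase => [[HBad [g [stk [Hsch Hinv]]]]|[HBad [g [t [c [sp [stk [v [Hrel Hinv HV Hv]]]]]]]]].
  left; split => // t Ht; rewrite K7 in Ht.
  apply: (feasible_schedule wfH (inv_done Hinv) Hn4 Hn5) => x Hx.
  by rewrite Ht // Hsch.
right; split => //.
have [U [Uv Upos Ucl]] := lifted_closed (F_lt wfH) Hw3 Hinv Hv.
have Hlif u : U u -> (lifter g u < size (arcs H))%N /\ tln H (lifter g u) = u.
  by move=> /Upos Hu; apply: (inv_lifter Hinv).
exists (lifter g), U, v; split => //.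
  move=> l Hu Hne HlU Hcl.
  apply: (@strategy_negative_cycle H wfH (sch g) (time g)) => //.
  - by move=> u /HlU /Hlif.
  - by move=> u e /HlU /Upos Hu0 He; apply: (inv_tight Hinv).
  - by move=> u u' /HlU /Upos Hu1 /HlU /Upos Hu2; apply: (inv_time Hinv).
split.
- exact: (sta_off Hst).
- exact: (sta_head Hst).
- exact: (rl_lift Hrel).
- exact: (sta_zero Hst).
Qed.

Lemma solved_bad H B s : wf H -> solved H B s ->
  (hreg s rBad = 0 /\ consistent H) \/ (hreg s rBad = 1 /\ ~ consistent H).
Proof.
move=> wfH Hs; case: (sv_case Hs) => [[HB Hf]|[HB [Sg [U [v [[_ Uv] HU Hcl Hneg _]]]]]].
  left; split => //; eexists; apply: (Hf (fun x => harr s fSch x)).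
  by [].
right; split => //.
(* [U] is only a predicate; its nodes are tails, so filtering the tails enumerates it. *)
pose l := undup [seq u <- [seq tln H i | i <- iota 0 (size (arcs H))] | U u].
have Hl u : (u \in l) = U u.
  rewrite mem_undup mem_filter andb_idr // => Hu; have [H1 H2] := HU u Hu.
  by rewrite -H2 map_f // mem_iota.
apply: (@negative_cycle_inconsistent H wfH l (map Sg l)).
apply: Hneg.
- exact: undup_uniq.
- by apply/eqP => E; have := Hl v; rewrite E Uv.
- by move=> u; rewrite Hl.
- by move=> u e; rewrite !Hl; apply: Hcl.
Qed.

Definition total_cost (H : hytn) : nat :=
  (solve_cost H + (size (arcs H) * (8 * nent H + 20) + 8 * size (arcs H) + nnodes H + 30))%N.

Lemma msizeE H : msize H = (nent H + size (arcs H))%N.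
Proof.
rewrite /msize; case: H => n l /=.
elim: l => [|A l IH]; first by rewrite big_nil off0.
by rewrite big_cons IH /= off_cons size_map; lia.
Qed.

(** Lifting costs about [(a * W + 1) * m], the search [a * m], reading the input [m], and the output
    |V|; each is dominated by a term of [tbound]. The constant is merely generous. *)
Lemma total_cost_le : exists c : nat, forall H,
  (2 * (26 * size (encode H) + 3200 + 20 * total_cost H) <= c * tbound H)%N.
Proof.
exists (300 * 100)%N => H; rewrite size_encode /total_cost /solve_cost /tbound msizeE.
set a := size (arcs H); set E := off _ _; set n := nnodes H; set W := Wmax H.
set m := (E + a)%N; set V := maxn W 1; set X := ((n + a) * m * V)%N.
(* Without arcs there are no heads, so [m] vanishes; this saves the comparison of [m * V] with
   [a * m * V] when [a = 0]. *)
have E0 : a = 0%N -> E = 0%N by rewrite /E => ->; rewrite off0.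
have HV : (0 < V)%N by rewrite /V; lia.
have Ham : (a * m * V <= X)%N by rewrite /X leq_mul2r leq_mul2r leq_addl !orbT.
have Hm : (m * V <= a * m * V)%N.
  have [Ea|Ha] := posnP a; first by rewrite /m E0 // Ea.
  by rewrite -mulnA leq_pmull.
have Hm2 : (m <= m * V)%N by rewrite leq_pmulr.
have Ham2 : (a * m <= a * m * V)%N by rewrite leq_pmulr.
have HaW : ((a * W) * m <= a * m * V)%N.
  by rewrite mulnAC leq_mul2l leq_maxl orbT.
have H1 : ((a * W).+1 * (6 * a + 4 * E) <= 6 * ((a * W) * m + m))%N.
  apply: (@leq_trans ((a * W).+1 * (6 * m))); first by rewrite leq_mul2l /m; lia.
  by rewrite mulnCA (mulSn (a * W)) (addnC m).
have H2 : (a * (8 * E + 20) <= 8 * (a * m) + 20 * m)%N.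
  rewrite mulnDr (mulnCA a 8) (mulnC a 20) leq_add //; last by rewrite /m; lia.
  by rewrite leq_mul2l leq_mul2l leq_addr !orbT.
have Ha : (a <= m)%N by rewrite leq_addl.
have HE : (E <= m)%N by rewrite leq_addr.
move: (_.+1 * _)%N (a * (_ + 20))%N (a * W * m)%N (a * m)%N (a * m * V)%N (m * V)%N H1 H2 HaW Ham2 Hm2 Hm Ham
  => Z1 Z2 Z3 Z4 Z5 Z6 *; lia.
Qed.

(** * The three programs and their specifications *)

Definition decide_prog : hcmd :=
  read_input ;; main_loop ;; hSub rX rOne rBad ;; hPut fOut rZero rX ;; hConst rLen 1.
Definition schedule_prog : hcmd := read_input ;; main_loop ;; Skip.
Definition cycle_prog : hcmd := read_input ;; main_loop ;; extract_cycle.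

Lemma compile_total H c f (post : hst -> Prop) C : wf H -> hcmd_ok c -> (f < 16)%N ->
  (2 * (26 * size (encode H) + 3200 + 20 * total_cost H) <= C * tbound H)%N ->
  (forall B s, loaded H B s ->
     hwp c s (total_cost H)%:Z (fun s' k' => 0 <= k' /\ exists2 n : nat,
        hreg s' rLen = n%:Z /\ (n <= B)%N & (n <= total_cost H)%N /\ post s')) ->
  exists (M : memory) s (n : nat), [/\ post s, hreg s rLen = n%:Z,
    forall x, (x < n)%N -> M x = harr s f x &
    halts_within (compile c f) (init H) (C * tbound H) M].
Proof.
move=> wfH Hc Hf HC Hpost.
have [M [s [n [Hp Hn HM Hh]]]] := compileP wfH Hc Hf Hpost.
by exists M, s, n; split => //; apply: halts_within_le Hh.
Qed.

Lemma decide_correct H C : wf H ->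
  (2 * (26 * size (encode H) + 3200 + 20 * total_cost H) <= C * tbound H)%N ->
  exists M, halts_within (compile decide_prog fOut) (init H) (C * tbound H) M /\
    (out_bool M <-> consistent H).
Proof.
move=> wfH HC.
have [//|||M [s [n [Hp Hn HM Hh]]]] := @compile_total H decide_prog fOut (fun s =>
  hreg s rLen = 1 /\
  ((harr s fOut 0 = 1 /\ consistent H) \/ (harr s fOut 0 = 0 /\ ~ consistent H)))
  C wfH _ _ HC.
- by [].
- move=> B s Hs; apply: (hwp_solve wfH Hs); first by rewrite /total_cost; lia.
  move=> [R A] k1 Hsol Hk1; have Hb := solved_bad wfH Hsol.
  have [/= R3 R4] := sv_reg Hsol.
  have HB : (1 <= B)%N by apply: leq_trans (ld_size Hs); rewrite size_encode.
  apply: wp_act_seq => //=; apply: wp_act_seq => /=; first by rewrite R3.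
  rewrite R3 absz0; apply: wp_act => //=.
  split; first by rewrite /total_cost in Hk1; lia.
  exists 1%N => //; split; first by rewrite /total_cost; lia.
  split => //; rewrite R4 /= in Hb *.
  by case: Hb => -[-> ?]; [left | right].
exists M; split => //; rewrite /out_bool.
case: Hp => Hl Hp; rewrite Hl in Hn; case: Hn => En.
rewrite HM -?En //; case: Hp => -[-> Hc]; first by split.
by split.
Qed.

Lemma schedule_correct H C : wf H -> consistent H ->
  (2 * (26 * size (encode H) + 3200 + 20 * total_cost H) <= C * tbound H)%N ->
  exists M, halts_within (compile schedule_prog fSch) (init H) (C * tbound H) M /\
    feasible H (fun v => ((out_sched M v)%:~R : R)).
Proof.
move=> wfH Hcons HC.
have [//|||M [s [n [Hp Hn HM Hh]]]] := @compile_total H schedule_prog fSch (fun s =>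
  forall t : nat -> int, (forall x, x%:Z < hreg s rLen -> t x = harr s fSch x) ->
       feasible H (fun x => (t x)%:~R)) C wfH _ _ HC.
- by [].
- move=> B s Hs; apply: (hwp_solve wfH Hs); first by rewrite /total_cost; lia.
  move=> s1 k1 Hsol Hk1; have Hb := solved_bad wfH Hsol.
  apply: wp_skip; split; first by rewrite /total_cost in Hk1; lia.
  have [m [H1 H2 H3]] := sv_len Hsol; exists m => //.
  split; first by rewrite /total_cost; lia.
  case: (sv_case Hsol) => [[_ Hf]//|[Hbad _]].
  by case: Hb => -[Hbad' Hnc //]; rewrite Hbad in Hbad'.
exists M; split => //; apply: Hp => x; rewrite Hn => Hx.
exact: HM.
Qed.

Lemma cycle_correct H C : wf H -> ~ consistent H ->
  (2 * (26 * size (encode H) + 3200 + 20 * total_cost H) <= C * tbound H)%N ->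
  exists M, halts_within (compile cycle_prog fOut) (init H) (C * tbound H) M /\
    is_negative_cycle H (out_S M) (out_C M).
Proof.
move=> wfH Hcons HC.
have [//|||M [s [n [[Sg [l [Hco Hneg]]] Hn HM Hh]]]] := @compile_total H cycle_prog fOut
  (fun s => exists Sg l, cycle_out Sg l s /\ is_negative_cycle H l (map Sg l)) C wfH _ _ HC.
- by [].
- move=> B s Hs; apply: (hwp_solve wfH Hs); first by rewrite /total_cost; lia.
  move=> [R A] k1 Hsol Hk1; have Hb := solved_bad wfH Hsol.
  case: (sv_case Hsol) => [[Hbad _]|[_ [Sg [U [v [[HV Uv] HU Hcl Hneg [A1 A2 A3 A4]]]]]]].
    by case: Hb => -[Hbad' Hnc //]; rewrite Hbad in Hbad'.
  have [/= R3 R4] := sv_reg Hsol; rewrite /= in HV A1 A2 A3 A4.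
  apply: (@hwp_extract_cycle H Sg U v HU Hcl Uv) => //.
    by rewrite /total_cost in Hk1; lia.
  move=> s2 l k2 Hco Hu Hv HlU Hlcl Hsz Hk2.
  split; first by rewrite /total_cost in Hk1; lia.
  exists (2 * size l + 2)%N; first split.
  - exact: co_len Hco.
  - by apply: leq_trans (ld_size Hs); rewrite size_encode; lia.
  - split; first by rewrite /total_cost; lia.
    exists Sg, l; split => //; apply: Hneg => //.
    by case: (l) Hv.
exists M; split => //.
have En : n = (2 * size l + 2)%N by have := co_len Hco; rewrite Hn => -[].
have M0 : M 0%N = (size l)%:Z by rewrite HM ?(co_size Hco) // En; lia.
have -> : out_S M = l.
  rewrite /out_S M0 absz_nat; apply: (@eq_from_nth _ 0%N); first by rewrite size_map size_iota.
  move=> i; rewrite size_map size_iota => Hi.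
  rewrite (nth_map 0%N) ?size_iota // nth_iota // add0n HM; last by rewrite En; lia.
  by rewrite (co_node Hco) // absz_nat.
have -> // : out_C M = map Sg l.
rewrite /out_C M0 absz_nat HM; last by rewrite En; lia.
rewrite (co_size2 Hco) absz_nat; apply: (@eq_from_nth _ 0%N).
  by rewrite !size_map size_iota.
move=> i; rewrite size_map size_iota => Hi.
rewrite (nth_map 0%N) ?size_iota // nth_iota // add0n HM; last by rewrite En; lia.
by rewrite (co_arc Hco) // absz_nat (nth_map 0%N).
Qed.

Theorem mainTheorem10 :
  (* (1) deciding consistency *)
  (exists (P : program) (c : nat), forall H : hytn, wf H ->
     exists M : memory, halts_within P (init H) (c * tbound H) M /\
       (out_bool M <-> consistent H)) /\
  (* (2) integral feasible scheduling for consistent instances *)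
  (exists (P : program) (c : nat), forall H : hytn, wf H -> consistent H ->
     exists M : memory, halts_within P (init H) (c * tbound H) M /\
       feasible H (fun v => ((out_sched M v)%:~R : R))) /\
  (* (3) negative cycle for non-consistent instances *)
  (exists (P : program) (c : nat), forall H : hytn, wf H -> ~ consistent H ->
     exists M : memory, halts_within P (init H) (c * tbound H) M /\
       is_negative_cycle H (out_S M) (out_C M)).
Proof.
have [C HC] := total_cost_le; split; [|split].
- exists (compile decide_prog fOut), C => H wfH; exact: decide_correct.
- exists (compile schedule_prog fSch), C => H wfH Hc; exact: schedule_correct.
- exists (compile cycle_prog fOut), C => H wfH Hc; exact: cycle_correct.
Qed.
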